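(* Let $j\in\{1,2,3\}$, so that $p_j\in\{2,3,5\}$. Then every natural number $N>5040$ with $p_j\nmid N$ satisfies Robin's inequality $\sigma(N)<e^\gamma N\log(\log N)$.
   Context: $p_1=2<p_2=3<p_3=5<\cdots$ denotes the increasing enumeration of the primes. $\sigma(N)=\sum_{d\mid N}d$ is the sum-of-divisors function and $\gamma$ is the Euler–Mascheroni constant. *)

(* Defs.v *)
From Stdlib Require Import Reals Lra Lia ZArith Znumtheory List.
From Coquelicot Require Import Coquelicot.
Open Scope R_scope.

Definition sigma_div (N : nat) : nat :=
  fold_right Nat.add 0%nat
    (filter (fun d => Nat.eqb (Nat.modulo N d) 0) (seq 1 N)).

Definition nat_prime (p : nat) : Prop := prime (Z.of_nat p).

Definition nat_primeb (p : nat) : bool :=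
  if prime_dec (Z.of_nat p) then true else false.

Definition prime_count_below (m : nat) : nat :=
  length (filter nat_primeb (seq 0 m)).

(* p_j : the j-th prime in increasing order (p_1 = 2, p_2 = 3, ...), j >= 1:
   p is prime and exactly j-1 primes are smaller than p *)
Definition is_jth_prime (j p : nat) : Prop :=
  nat_prime p /\ prime_count_below p = (j - 1)%nat.

Definition harmonic (n : nat) : R :=
  fold_right Rplus 0 (map (fun k => / INR k) (seq 1 n)).

Definition euler_gamma : R :=
  real (Lim_seq (fun n => harmonic n - ln (INR n))).

(* Main.v *)
Require Import Defs.
From Stdlib Require Import Reals ZArith Znumtheory List.
From Coquelicot Require Import Coquelicot.
From Stdlib Require Import Lra Lia Psatz Arith Bool.
From Stdlib Require FinFun.
Open Scope R_scope.

(** Let [p <= 5] be a prime not dividing [n]. Then [sigma n / n] is less than the product of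
    [q / (q - 1)] over the primes [q] dividing [n]. Adjoining [p] and replacing the resulting set
    of primes by the equally many smallest primes, those up to [x], gives
    [sigma n / n <= (1 - 1/p) P x <= 4/5 P x] with [P x] the product of [q / (q - 1)] over
    [q <= x], and [ln n >= theta x - ln 5]. Hence it suffices that
    [4/5 P x < exp gamma * ln (theta x - ln 5)], where the factor [4/5] leaves room for crude
    explicit forms of the theorems of Chebyshev and Mertens.

    The bound on [P] with the exact constant [exp gamma] comes from comparing two singular sums:
    the lower bound [A t >= ln (t + 1) - 1] for [A t], the sum of [ln q / (q - 1)] over [q <= t],
    gives by partial summation a lower bound for the sum of [1 / q] over [x < q <= y], with main
    term [ln ln y]. Weighting it by [q ^ (- d)] over dyadic blocks, the Euler product (at most
    [1 + 1/d]) is compared with the logarithmic series at [2 ^ (- d)], and [gamma] enters because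
    the harmonic number [H m] is at most [ln (m + 1) + gamma]. Letting [d] tend to 0 gives
    [ln (P x) <= gamma + ln ln (x + 1) + (A x + 1) / ln (x + 1) - 1 + 1 / x].

    This settles [x >= 2 ^ 15]; a computation settles [19 <= x <= 2 ^ 15]. For smaller [x]
    the bound [n > 5040] suffices, except when [p = 5] and [n] is even, where the exact
    contribution of the prime 2 is taken into account. *)

(** * Finite sums and primes *)

Definition Rsum (f : nat -> R) (l : list nat) : R :=
  fold_right (fun k s => f k + s) 0 l.

Lemma Rsum_app f l1 l2 : Rsum f (l1 ++ l2) = Rsum f l1 + Rsum f l2.
Proof. induction l1 as [|a l1 IH]; simpl; [lra | rewrite IH; lra]. Qed.

Lemma Rsum_le f g l : (forall k, In k l -> f k <= g k) -> Rsum f l <= Rsum g l.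
Proof.
  induction l as [|a l IH]; simpl; intros H; [lra|].
  assert (f a <= g a) by auto. assert (Rsum f l <= Rsum g l) by auto. lra.
Qed.

Lemma Rsum_ext f g l : (forall k, In k l -> f k = g k) -> Rsum f l = Rsum g l.
Proof. intros H; apply Rle_antisym; apply Rsum_le; intros k Hk; rewrite (H k Hk); lra. Qed.

Lemma Rsum_plus f g l : Rsum (fun k => f k + g k) l = Rsum f l + Rsum g l.
Proof. induction l as [|a l IH]; simpl; [lra | rewrite IH; lra]. Qed.

Lemma Rsum_minus f g l : Rsum (fun k => f k - g k) l = Rsum f l - Rsum g l.
Proof. induction l as [|a l IH]; simpl; [lra | rewrite IH; lra]. Qed.

Lemma Rsum_scal c f l : Rsum (fun k => c * f k) l = c * Rsum f l.
Proof. induction l as [|a l IH]; simpl; [lra | rewrite IH; lra]. Qed.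

Lemma Rsum_const c l : Rsum (fun _ => c) l = c * INR (length l).
Proof.
  induction l as [|a l IH]; [simpl; lra|].
  change (length (a :: l)) with (S (length l)). rewrite S_INR. simpl. rewrite IH. lra.
Qed.

Lemma Rsum_nonneg f l : (forall k, In k l -> 0 <= f k) -> 0 <= Rsum f l.
Proof.
  intros H. replace 0 with (Rsum (fun _ => 0) l) by (rewrite Rsum_const; lra).
  now apply Rsum_le.
Qed.

Lemma Rsum_map f h l : Rsum f (map h l) = Rsum (fun k => f (h k)) l.
Proof. induction l as [|a l IH]; simpl; [lra | rewrite IH; lra]. Qed.

Lemma Rsum_flat_map f (h : nat -> list nat) l :
  Rsum f (flat_map h l) = Rsum (fun k => Rsum f (h k)) l.
Proof. induction l as [|a l IH]; simpl; [lra | rewrite Rsum_app, IH; lra]. Qed.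

Lemma Rsum_filter f (P : nat -> bool) l :
  Rsum f (filter P l) = Rsum (fun k => if P k then f k else 0) l.
Proof. induction l as [|a l IH]; simpl; [lra | destruct (P a); simpl; lra]. Qed.

Lemma Rsum_incl f l1 l2 :
  NoDup l1 -> incl l1 l2 -> (forall k, In k l2 -> 0 <= f k) -> Rsum f l1 <= Rsum f l2.
Proof.
  intros Hnd; revert l2; induction Hnd as [|a l1 Ha Hnd IH]; intros l2 Hin Hpos.
  - simpl. now apply Rsum_nonneg.
  - destruct (in_split a l2) as [u [v ->]]; [apply Hin; now left|].
    simpl. rewrite Rsum_app; simpl.
    assert (Rsum f l1 <= Rsum f (u ++ v)).
    { apply IH.
      - intros k Hk. assert (Hk2 : In k (u ++ a :: v)) by (apply Hin; now right).
        apply in_app_iff in Hk2. apply in_app_iff. simpl in Hk2.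
        destruct Hk2 as [|[->|]]; tauto.
      - intros k Hk. apply Hpos. apply in_app_iff in Hk. apply in_app_iff. simpl. tauto. }
    rewrite Rsum_app in H. lra.
Qed.

Lemma seq_snoc a n : seq a (S n) = seq a n ++ (a + n)%nat :: nil.
Proof. now rewrite seq_S. Qed.

Definition primes_to (n : nat) : list nat := filter nat_primeb (seq 1 n).

Lemma nat_primeb_iff p : nat_primeb p = true <-> nat_prime p.
Proof. unfold nat_primeb, nat_prime. destruct (prime_dec (Z.of_nat p)); intuition congruence. Qed.

Lemma nat_prime_ge2 p : nat_prime p -> (2 <= p)%nat.
Proof. intros H. apply prime_ge_2 in H. lia. Qed.

Lemma in_primes_to p n : In p (primes_to n) <-> nat_prime p /\ (p <= n)%nat.
Proof.
  unfold primes_to. rewrite filter_In, in_seq, nat_primeb_iff. split.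
  - intros [[H1 H2] H3]. split; [auto|lia].
  - intros [H1 H2]. apply nat_prime_ge2 in H1 as H3. split; [lia|auto].
Qed.

Lemma NoDup_primes_to n : NoDup (primes_to n).
Proof. apply NoDup_filter, seq_NoDup. Qed.

Lemma primes_to_S n :
  primes_to (S n) = primes_to n ++ (if nat_primeb (S n) then S n :: nil else nil).
Proof.
  unfold primes_to. rewrite seq_snoc, filter_app. reflexivity.
Qed.

Lemma Rsum_primes_S f n :
  Rsum f (primes_to (S n)) = Rsum f (primes_to n) + (if nat_primeb (S n) then f (S n) else 0).
Proof. rewrite primes_to_S, Rsum_app. destruct (nat_primeb (S n)); simpl; lra. Qed.

Lemma Rsum_primes_mono f m n :
  (m <= n)%nat -> (forall p, nat_prime p -> 0 <= f p) ->
  Rsum f (primes_to m) <= Rsum f (primes_to n).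
Proof.
  intros Hmn Hf. apply Rsum_incl; [apply NoDup_primes_to | | ].
  - intros p Hp. apply in_primes_to in Hp. apply in_primes_to. split; [tauto|lia].
  - intros p Hp. apply in_primes_to in Hp. apply Hf; tauto.
Qed.

Lemma nat_prime_divide_mul p a b :
  nat_prime p -> Nat.divide p (a * b) -> Nat.divide p a \/ Nat.divide p b.
Proof.
  intros Hp [k Hk].
  assert (H : (Z.of_nat p | Z.of_nat a * Z.of_nat b)%Z).
  { exists (Z.of_nat k). lia. }
  destruct (prime_mult _ Hp _ _ H) as [[c Hc]|[c Hc]]; [left|right];
    apply nat_prime_ge2 in Hp; exists (Z.to_nat c); nia.
Qed.

Lemma nat_prime_divide_prime p q : nat_prime p -> nat_prime q -> Nat.divide p q -> p = q.
Proof.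
  intros Hp Hq [k Hk]. 
  assert (H : (Z.of_nat p | Z.of_nat q)%Z) by (exists (Z.of_nat k); lia).
  apply prime_div_prime in H; auto. lia.
Qed.

Lemma exists_prime_divisor n : (2 <= n)%nat -> exists p, nat_prime p /\ Nat.divide p n.
Proof.
  induction n as [n IH] using lt_wf_ind; intros Hn.
  destruct (prime_dec (Z.of_nat n)) as [Hp|Hp].
  - exists n. split; auto. apply Nat.divide_refl.
  - destruct (not_prime_divide (Z.of_nat n) ltac:(lia) Hp) as [q [Hq [k Hk]]].
    destruct (IH (Z.to_nat q) ltac:(lia) ltac:(lia)) as [p [Hp1 Hp2]].
    exists p; split; auto. apply Nat.divide_trans with (1 := Hp2).
    exists (Z.to_nat k). nia.
Qed.

Lemma ln_le_sub_1 x : 0 < x -> ln x <= x - 1.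
Proof.
  intros Hx. pose proof (exp_ineq1_le (ln x)) as H. rewrite exp_ln in H by auto. lra.
Qed.

Lemma INR_prime_ge2 p : nat_prime p -> 2 <= INR p.
Proof. intros H. apply nat_prime_ge2 in H. apply le_INR in H. simpl in H. lra. Qed.

Lemma INR_le_1 n : (1 <= n)%nat -> 1 <= INR n.
Proof. intros H. apply le_INR in H. simpl in H. lra. Qed.

Lemma ln_le_mono x y : 0 < x -> x <= y -> ln x <= ln y.
Proof. intros H1 [H|<-]; [left; now apply ln_increasing|lra]. Qed.

Lemma ln_nonneg x : 1 <= x -> 0 <= ln x.
Proof. intros H. rewrite <- ln_1. apply ln_le_mono; lra. Qed.

Lemma ln_INR_nonneg n : 0 <= ln (INR n).
Proof.
  destruct n as [|n].
  (* [ln] takes the value 0 off the positive reals, so the case [n = 0] holds as well. *)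
  - change (INR 0) with 0. unfold ln. destruct (Rlt_dec 0 0) as [h|h]; [exfalso; lra|lra].
  - apply ln_nonneg, INR_le_1. lia.
Qed.

Lemma ln_INR_prime_pos p : nat_prime p -> 0 < ln (INR p).
Proof. intros H. apply INR_prime_ge2 in H. rewrite <- ln_1. apply ln_increasing; lra. Qed.

(** * Legendre's formula *)

Definition ind (b : bool) : R := if b then 1 else 0.

Lemma ind_nonneg b : 0 <= ind b.
Proof. destruct b; simpl; lra. Qed.

(** The [p]-adic valuation of [m >= 1], counted as the number of powers [p ^ k] dividing it. The
    cutoff [K] is harmless once [m <= K], because [k < p ^ k]. *)
Definition val_count (K p m : nat) : R :=
  Rsum (fun k => ind (m mod p ^ k =? 0)%nat) (seq 1 K).

(** Legendre's expression for the exponent of [p] in [n!], exact for [n <= K]. *)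
Definition val_fact (K p n : nat) : R :=
  Rsum (fun k => INR (n / p ^ k)) (seq 1 K).

Definition ln_fact (n : nat) : R := Rsum (fun m => ln (INR m)) (seq 1 n).

Lemma mod_eqb_divide a b : (0 < b)%nat -> ((a mod b =? 0) = true <-> Nat.divide b a)%nat.
Proof. intros H. rewrite Nat.eqb_eq. apply Nat.Lcm0.mod_divide. Qed.

Lemma bool_iff_eq (a b : bool) : (a = true <-> b = true) -> a = b.
Proof. destruct a, b; intuition congruence. Qed.

Lemma Rsum_seq_shift f K :
  Rsum f (seq 1 (S K)) = f 1%nat + Rsum (fun k => f (S k)) (seq 1 K).
Proof. simpl. rewrite <- seq_shift, Rsum_map. reflexivity. Qed.

Lemma Rsum_seq_snoc f K : Rsum f (seq 1 (S K)) = Rsum f (seq 1 K) + f (S K).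
Proof. rewrite seq_snoc, Rsum_app. simpl. lra. Qed.

Lemma Rsum_single f q l :
  NoDup l -> In q l -> Rsum (fun p => f p * ind (p =? q)%nat) l = f q.
Proof.
  induction 1 as [|a l Ha Hnd IH]; simpl; [tauto|].
  intros [->|Hq].
  - rewrite Nat.eqb_refl. simpl.
    rewrite (Rsum_ext _ (fun _ => 0)); [rewrite Rsum_const; lra|].
    intros k Hk. destruct (Nat.eqb_spec k q); [subst; tauto | simpl; lra].
  - destruct (Nat.eqb_spec a q); [subst; tauto|]. simpl. rewrite IH by auto. lra.
Qed.

Lemma pow_pos_nat p k : (2 <= p)%nat -> (0 < p ^ k)%nat.
Proof. intros H. assert (p ^ k <> 0)%nat by (apply Nat.pow_nonzero; lia). lia. Qed.

Lemma pow_gt_exponent q k : (2 <= q)%nat -> (k < q ^ k)%nat.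
Proof. intros H. apply Nat.pow_gt_lin_r. lia. Qed.

Lemma prime_power_divide_cancel p q k m :
  nat_prime p -> ~ Nat.divide p q -> Nat.divide (p ^ k) (q * m) -> Nat.divide (p ^ k) m.
Proof.
  intros Hp Hpq. revert m. induction k as [|k IH]; intros m Hd.
  - apply Nat.divide_1_l.
  - assert (Hp2 := nat_prime_ge2 p Hp).
    assert (H1 : Nat.divide p (q * m)).
    { apply Nat.divide_trans with (2 := Hd). exists (p ^ k)%nat. simpl. lia. }
    destruct (nat_prime_divide_mul _ _ _ Hp H1) as [|[m2 ->]]; [tauto|].
    replace (p ^ S k)%nat with (p ^ k * p)%nat in * by (simpl; lia).
    apply Nat.mul_divide_mono_r. apply IH.
    apply Nat.mul_divide_cancel_r with p; [lia|].
    now rewrite <- Nat.mul_assoc.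
Qed.

(** For [p = q] the count shifts by one place: [p ^ (k + 1)] divides [p * m] exactly when [p ^ k]
    divides [m]. The term of [m] at the cutoff [K] is 0 since [m <= K < p ^ K]. *)
Lemma val_count_mul_prime K p q m :
  nat_prime p -> nat_prime q -> (1 <= m)%nat -> (m <= K)%nat -> (1 <= K)%nat ->
  val_count K p (q * m) = val_count K p m + ind (p =? q)%nat.
Proof.
  intros Hp Hq Hm HmK HK. assert (Hp2 := nat_prime_ge2 p Hp).
  destruct (Nat.eqb_spec p q) as [<-|Hpq].
  - destruct K as [|K]; [lia|]. unfold val_count.
    rewrite Rsum_seq_shift, (Rsum_seq_snoc _ K).
    replace (p * m mod p ^ 1 =? 0)%nat with true.
    2:{ symmetry. rewrite mod_eqb_divide by (apply pow_pos_nat; auto). exists m. simpl; lia. }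
    replace (m mod p ^ S K =? 0)%nat with false.
    2:{ symmetry. apply Nat.eqb_neq. pose proof (pow_gt_exponent p (S K) Hp2).
        rewrite Nat.mod_small; lia. }
    simpl ind.
    rewrite (Rsum_ext (fun k => ind (p * m mod p ^ S k =? 0)%nat) (fun k => ind (m mod p ^ k =? 0)%nat)).
    lra.
    intros k _. f_equal. apply bool_iff_eq.
    rewrite !mod_eqb_divide by (apply pow_pos_nat; auto). simpl.
    split; intros H; [|now apply Nat.mul_divide_mono_l].
    apply Nat.mul_divide_cancel_l in H; auto; lia.
  - simpl ind. rewrite Rplus_0_r. apply Rsum_ext. intros k _. f_equal. apply bool_iff_eq.
    rewrite !mod_eqb_divide by (apply pow_pos_nat; auto). split; intros H.
    + apply prime_power_divide_cancel with q; auto.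
      intros Hd. apply Hpq. now apply nat_prime_divide_prime.
    + now apply Nat.divide_mul_r.
Qed.

(** Unique factorization in logarithmic form, by splitting one prime [q] off [m]. *)
Lemma ln_prime_decomp N K m :
  (1 <= m)%nat -> (m <= N)%nat -> (m <= K)%nat ->
  ln (INR m) = Rsum (fun p => ln (INR p) * val_count K p m) (primes_to N).
Proof.
  revert m. induction m as [m IH] using lt_wf_ind. intros H1 HN HK.
  destruct (Nat.eq_dec m 1) as [->|Hm].
  - simpl INR. rewrite ln_1. rewrite (Rsum_ext _ (fun _ => 0)); [rewrite Rsum_const; lra|].
    intros p Hp. apply in_primes_to in Hp. destruct Hp as [Hp _].
    unfold val_count. rewrite (Rsum_ext _ (fun _ => 0)); [rewrite Rsum_const; lra|].
    intros k Hk. apply in_seq in Hk. assert (Hp2 := nat_prime_ge2 p Hp).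
    pose proof (pow_gt_exponent p k Hp2). rewrite Nat.mod_small by lia. reflexivity.
  - destruct (exists_prime_divisor m ltac:(lia)) as [q [Hq [m' Hm']]].
    assert (Hq2 := nat_prime_ge2 q Hq). rewrite Nat.mul_comm in Hm'. subst m.
    assert (1 <= m')%nat by nia.
    rewrite (Rsum_ext _ (fun p => ln (INR p) * val_count K p m' + ln (INR p) * ind (p =? q)%nat)).
    + rewrite Rsum_plus, <- IH by nia.
      rewrite Rsum_single; [ | apply NoDup_primes_to | apply in_primes_to; split; [auto|nia] ].
      rewrite mult_INR, ln_mult; [lra | |]; apply lt_0_INR; lia.
    + intros p Hp. apply in_primes_to in Hp.
      rewrite val_count_mul_prime; [lra | tauto | auto | lia | nia | nia].
Qed.

Lemma div_S n d : (1 <= d)%nat -> INR (S n / d) = INR (n / d) + ind (S n mod d =? 0)%nat.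
Proof.
  intros Hd.
  assert (E := Nat.div_mod_eq n d). assert (E' := Nat.div_mod_eq (S n) d).
  assert (B := Nat.mod_upper_bound n d ltac:(lia)).
  assert (B' := Nat.mod_upper_bound (S n) d ltac:(lia)).
  destruct (Nat.eqb_spec (S n mod d) 0) as [h|h]; simpl ind.
  - replace (S n / d)%nat with (S (n / d)) by nia. rewrite S_INR. lra.
  - replace (S n / d)%nat with (n / d)%nat by nia. lra.
Qed.

(** Passing from [n] to [n + 1] raises the floor of [n / p ^ k] by one exactly when [p ^ k] divides
    [n + 1]. Free cutoffs [N] and [K] allow several factorials to be expanded over one list of
    primes. *)
Lemma legendre N K n :
  (n <= N)%nat -> (n <= K)%nat ->
  ln_fact n = Rsum (fun p => ln (INR p) * val_fact K p n) (primes_to N).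
Proof.
  induction n as [|n IH]; intros HN HK.
  - unfold ln_fact. simpl. rewrite (Rsum_ext _ (fun _ => 0)); [rewrite Rsum_const; lra|].
    intros p Hp. apply in_primes_to in Hp. destruct Hp as [Hp _].
    unfold val_fact. rewrite (Rsum_ext _ (fun _ => 0)); [rewrite Rsum_const; lra|].
    intros k Hk. rewrite Nat.Div0.div_0_l. reflexivity.
  - unfold ln_fact. rewrite Rsum_seq_snoc. fold (ln_fact n). rewrite IH by lia.
    rewrite (ln_prime_decomp N K) by lia. rewrite <- Rsum_plus.
    apply Rsum_ext. intros p Hp. apply in_primes_to in Hp. destruct Hp as [Hp _].
    apply nat_prime_ge2 in Hp.
    unfold val_fact. rewrite (Rsum_ext (fun k => INR (S n / p ^ k))
      (fun k => INR (n / p ^ k) + ind (S n mod p ^ k =? 0)%nat)).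
    + rewrite Rsum_plus. unfold val_count. lra.
    + intros k _. apply div_S. pose proof (pow_pos_nat p k Hp). lia.
Qed.

(** * Explicit Chebyshev and Mertens bounds *)

Definition theta (n : nat) : R := Rsum (fun p => ln (INR p)) (primes_to n).

(** The weight is the full geometric series of [ln p / p ^ k] over [k >= 1], so that it dominates
    Legendre's formula without error term. *)
Definition mertens_sum (n : nat) : R :=
  Rsum (fun p => ln (INR p) / (INR p - 1)) (primes_to n).

Lemma ln_fact_S n : ln_fact (S n) = ln_fact n + ln (INR (S n)).
Proof. apply Rsum_seq_snoc. Qed.

(** A weak Stirling bound. Its shape, with [n + 1] inside the logarithm, yields [ln (n + 1) - 1]
    exactly after division by [n]. *)
Lemma ln_fact_lower n : INR n * (ln (INR n + 1) - 1) <= ln_fact n.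
Proof.
  induction n as [|n IH].
  - unfold ln_fact. simpl. lra.
  - rewrite ln_fact_S, S_INR. assert (Hn := pos_INR n).
    assert (H : ln ((INR n + 2) / (INR n + 1)) <= (INR n + 2) / (INR n + 1) - 1).
    { apply ln_le_sub_1, Rdiv_lt_0_compat; lra. }
    rewrite ln_div in H by lra.
    replace ((INR n + 2) / (INR n + 1) - 1) with (/ (INR n + 1)) in H by (field; lra).
    apply (Rmult_le_compat_l (INR n + 1)) in H; [|lra].
    rewrite Rinv_r in H by lra.
    replace (INR n + 1 + 1) with (INR n + 2) by ring. nra.
Qed.

Lemma ln_fact_upper n : (1 <= n)%nat -> ln_fact n <= INR n * (ln (INR n) - 1) + 1 + ln (INR n).
Proof.
  induction n as [|n IH]; [lia|intros _].
  destruct (Nat.eq_dec n 0) as [->|Hn0].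
  - unfold ln_fact. simpl. rewrite ln_1. lra.
  - specialize (IH ltac:(lia)). rewrite ln_fact_S, S_INR.
    assert (Hn := INR_le_1 n ltac:(lia)).
    assert (H : ln (INR n / (INR n + 1)) <= INR n / (INR n + 1) - 1).
    { apply ln_le_sub_1, Rdiv_lt_0_compat; lra. }
    rewrite ln_div in H by lra.
    replace (INR n / (INR n + 1) - 1) with (- / (INR n + 1)) in H by (field; lra).
    apply (Rmult_le_compat_l (INR n + 1)) in H; [|lra].
    replace ((INR n + 1) * (- / (INR n + 1))) with (-1) in H by (field; lra). nra.
Qed.

(** Iterated floors compose. This recursion from [n] to [n / p] drives the inductions on [K]
    below. *)
Lemma val_fact_S K p n :
  (2 <= p)%nat -> val_fact (S K) p n = INR (n / p) + val_fact K p (n / p).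
Proof.
  intros Hp. unfold val_fact. rewrite Rsum_seq_shift, Nat.pow_1_r. f_equal.
  apply Rsum_ext. intros k _. rewrite Nat.Div0.div_div. reflexivity.
Qed.

Lemma INR_div_mod n p : INR n = INR p * INR (n / p) + INR (n mod p).
Proof. rewrite <- mult_INR, <- plus_INR. f_equal. apply Nat.div_mod_eq. Qed.

Lemma val_fact_upper K p n : (2 <= p)%nat -> val_fact K p n <= INR n / (INR p - 1).
Proof.
  intros Hp. assert (Hp' : 2 <= INR p) by (apply le_INR in Hp; simpl in Hp; lra).
  revert n; induction K as [|K IH]; intros n.
  - unfold val_fact; simpl. apply Rdiv_le_0_compat; [apply pos_INR|lra].
  - rewrite val_fact_S by auto. specialize (IH (n / p)%nat).
    apply Rle_trans with (INR (n / p) + INR (n / p) / (INR p - 1)); [lra|].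
    rewrite (INR_div_mod n p). assert (H := pos_INR (n mod p)).
    apply Rminus_le_0.
    replace (_ - _) with (INR (n mod p) / (INR p - 1)) by (field; lra).
    apply Rdiv_le_0_compat; lra.
Qed.

Lemma INR_div_lower n p : (1 <= p)%nat -> INR n / INR p - 1 <= INR (n / p).
Proof.
  intros Hp. assert (Hp' := INR_le_1 p Hp). rewrite (INR_div_mod n p) at 1.
  assert (H : (n mod p <= p)%nat) by (pose proof (Nat.mod_upper_bound n p); lia).
  apply le_INR in H. apply Rminus_le_0.
  replace (_ - _) with ((INR p - INR (n mod p)) / INR p) by (field; lra).
  apply Rdiv_le_0_compat; lra.
Qed.

Lemma val_fact_zero K p : val_fact K p 0 = 0.
Proof.
  unfold val_fact. rewrite (Rsum_ext _ (fun _ => 0)); [rewrite Rsum_const; lra|].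
  intros k Hk. now rewrite Nat.Div0.div_0_l.
Qed.

(** The deficit is the base [p] digit sum of [n] divided by [p - 1]. Each digit contributes at most
    1, and there are at most [1 + ln n / ln p] digits. *)
Lemma val_fact_deficit K p n :
  (2 <= p)%nat -> (1 <= n)%nat -> (n <= K)%nat ->
  ln (INR p) * (INR n / (INR p - 1) - val_fact K p n) <= ln (INR n) + ln (INR p).
Proof.
  intros Hp. assert (Hp' : 2 <= INR p) by (apply le_INR in Hp; simpl in Hp; lra).
  assert (Hlp := ln_nonneg (INR p) ltac:(lra)).
  revert n; induction K as [|K IH]; intros n Hn HK; [lia|].
  rewrite val_fact_S by auto.
  assert (Hm := Nat.mod_upper_bound n p ltac:(lia)).
  assert (Hm' : INR (n mod p) / (INR p - 1) <= 1).
  { apply Rle_div_l; [lra|]. assert (H : (n mod p + 1 <= p)%nat) by lia.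
    apply le_INR in H. rewrite plus_INR in H. simpl in H. lra. }
  replace (INR n / (INR p - 1)) with
    (INR (n mod p) / (INR p - 1) + INR (n / p) + INR (n / p) / (INR p - 1))
    by (rewrite (INR_div_mod n p); field; lra).
  destruct (Nat.eq_dec (n / p) 0) as [->|Hq].
  - rewrite val_fact_zero. simpl INR. assert (Hln := ln_INR_nonneg n). nra.
  - assert (Hq2 : (n / p < n)%nat) by (apply Nat.div_lt; lia).
    specialize (IH (n / p)%nat ltac:(lia) ltac:(lia)).
    assert (ln (INR (n / p)) + ln (INR p) <= ln (INR n)).
    { assert (Hq1 := INR_le_1 (n / p) ltac:(lia)).
      rewrite <- ln_mult by lra. apply ln_le_mono; [nra|].
      rewrite (INR_div_mod n p). assert (H := pos_INR (n mod p)). lra. }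
    nra.
Qed.

(** Only the term [k = 1] of Legendre's formula is kept. This serves the large primes, over which
    [1 / (p * (p - 1))] has a small sum. *)
Lemma val_fact_deficit_large K p n :
  (2 <= p)%nat -> (1 <= K)%nat ->
  INR n / (INR p - 1) - val_fact K p n <= 1 + INR n / (INR p * (INR p - 1)).
Proof.
  intros Hp HK. assert (Hp' : 2 <= INR p) by (apply le_INR in Hp; simpl in Hp; lra).
  destruct K as [|K]; [lia|]. rewrite val_fact_S by auto.
  assert (H := INR_div_lower n p ltac:(lia)).
  assert (0 <= val_fact K p (n / p)) by (apply Rsum_nonneg; intros; apply pos_INR).
  replace (INR n / (INR p - 1)) with (INR n / INR p + INR n / (INR p * (INR p - 1)))
    by (field; lra).
  lra.
Qed.

(** Legendre's formula gives [ln n! <= n * mertens_sum n] term by term; Stirling then bounds the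
    left side from below. *)
Lemma mertens_sum_lower n : (1 <= n)%nat -> ln (INR n + 1) - 1 <= mertens_sum n.
Proof.
  intros Hn. assert (Hn' := INR_le_1 n Hn).
  assert (H := ln_fact_lower n). rewrite (legendre n n n) in H by lia.
  apply Rmult_le_reg_l with (INR n); [lra|]. apply Rle_trans with (1 := H).
  unfold mertens_sum. rewrite <- Rsum_scal. apply Rsum_le. intros p Hp.
  apply in_primes_to in Hp. destruct Hp as [Hp _].
  assert (Hlp := ln_INR_prime_pos p Hp). assert (Hp2 := INR_prime_ge2 p Hp).
  assert (H1 := val_fact_upper n p n (nat_prime_ge2 p Hp)).
  replace (INR n * (ln (INR p) / (INR p - 1))) with (ln (INR p) * (INR n / (INR p - 1)))
    by (field; lra).
  apply Rmult_le_compat_l; lra.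
Qed.

(** The terms telescope as [1 / (m - 1) - 1 / m]. The maximum makes the bound 0 while the sum is
    still empty. *)
Lemma tail_inverse_products n s :
  (1 <= s)%nat ->
  Rsum (fun m => ind (s <? m)%nat * / (INR m * (INR m - 1))) (seq 1 n)
    <= / INR s - / INR (Nat.max n s).
Proof.
  intros Hs. induction n as [|n IH].
  - simpl. lra.
  - rewrite Rsum_seq_snoc. destruct (Nat.ltb_spec s (S n)) as [h|h]; simpl ind.
    + rewrite (Nat.max_l n s) in IH by lia. rewrite (Nat.max_l (S n) s) by lia.
      assert (Hn := INR_le_1 n ltac:(lia)). rewrite S_INR.
      replace (1 * / ((INR n + 1) * (INR n + 1 - 1))) with (/ INR n - / (INR n + 1))
        by (field; lra). lra.
    + rewrite (Nat.max_r n s) in IH by lia. rewrite (Nat.max_r (S n) s) by lia. lra.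
Qed.

Lemma Rsum_primes_le_seq f n :
  (forall k, (1 <= k)%nat -> 0 <= f k) -> Rsum f (primes_to n) <= Rsum f (seq 1 n).
Proof.
  intros Hf. apply Rsum_incl; [apply NoDup_primes_to| |].
  - intros p Hp. unfold primes_to in Hp. apply filter_In in Hp. tauto.
  - intros k Hk. apply in_seq in Hk. apply Hf. lia.
Qed.

Lemma Rsum_ind_le n s : Rsum (fun m => ind (m <=? s)%nat) (seq 1 n) <= INR s.
Proof.
  assert (H : Rsum (fun m => ind (m <=? s)%nat) (seq 1 n) = INR (Nat.min n s)).
  { induction n as [|n IH]; [reflexivity|]. rewrite Rsum_seq_snoc, IH.
    destruct (Nat.leb_spec (S n) s); simpl ind.
    - rewrite !Nat.min_l by lia. now rewrite S_INR.
    - rewrite !Nat.min_r by lia. lra. }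
  rewrite H. apply le_INR. lia.
Qed.

(** Primes up to [s] use the digit bound, at most [ln n + ln p] each; larger ones use
    [val_fact_deficit_large]. The terms [ln p] add up to [theta n]. The two remaining errors balance
    for [s] near the square root of [n]. *)
Lemma mertens_sum_upper n s :
  (1 <= s)%nat -> (1 <= n)%nat ->
  INR n * mertens_sum n <=
    ln_fact n + theta n + INR s * ln (INR n) + INR n * ln (INR n) / INR s.
Proof.
  intros Hs Hn. assert (Hn' := INR_le_1 n Hn). assert (Hs' := INR_le_1 s Hs).
  assert (Hln := ln_INR_nonneg n).
  rewrite (legendre n n n) by lia. unfold mertens_sum, theta.
  set (e1 := fun m => ind (m <=? s)%nat).
  set (e2 := fun m => ind (s <? m)%nat * / (INR m * (INR m - 1))).
  assert (H1 : Rsum e1 (primes_to n) <= INR s).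
  { apply Rle_trans with (2 := Rsum_ind_le n s). apply Rsum_primes_le_seq.
    intros k _. apply ind_nonneg. }
  assert (H2 : Rsum e2 (primes_to n) <= / INR s).
  { apply Rle_trans with (Rsum e2 (seq 1 n)).
    - apply Rsum_primes_le_seq. intros k Hk. unfold e2.
      destruct (Nat.ltb_spec s k); simpl ind; [|lra]. rewrite Rmult_1_l.
      left. apply Rinv_0_lt_compat. assert (2 <= k)%nat as H0 by lia. apply le_INR in H0.
      simpl in H0. nra.
    - assert (H := tail_inverse_products n s Hs). fold e2 in H.
      assert (0 < / INR (Nat.max n s)).
      { apply Rinv_0_lt_compat. assert (1 <= INR (Nat.max n s)) by (apply INR_le_1; lia). lra. }
      lra. }
  apply Rle_trans with
    (Rsum (fun p => ln (INR p) * val_fact n p n) (primes_to n) +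
     Rsum (fun p => ln (INR p)) (primes_to n) +
     ln (INR n) * Rsum e1 (primes_to n) + INR n * ln (INR n) * Rsum e2 (primes_to n)).
  - rewrite <- !Rsum_scal, <- !Rsum_plus. apply Rsum_le. intros p Hp.
    apply in_primes_to in Hp. destruct Hp as [Hp Hpn].
    assert (Hlp := ln_INR_prime_pos p Hp). assert (Hp2 := INR_prime_ge2 p Hp).
    assert (Hp2' := nat_prime_ge2 p Hp).
    replace (INR n * (ln (INR p) / (INR p - 1))) with
      (ln (INR p) * val_fact n p n + ln (INR p) * (INR n / (INR p - 1) - val_fact n p n))
      by (field; lra).
    unfold e1, e2. destruct (Nat.ltb_spec s p) as [h|h].
    + replace (p <=? s)%nat with false by (symmetry; apply Nat.leb_gt; lia). simpl ind.
      assert (H := val_fact_deficit_large n p n Hp2' Hn).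
      apply (Rmult_le_compat_l (ln (INR p))) in H; [|lra].
      assert (Hl : ln (INR p) <= ln (INR n)) by (apply ln_le_mono; [lra|now apply le_INR]).
      assert (Hw : 0 <= INR n / (INR p * (INR p - 1))) by (apply Rdiv_le_0_compat; nra).
      replace (INR n * ln (INR n) * (1 * / (INR p * (INR p - 1)))) with
        (ln (INR n) * (INR n / (INR p * (INR p - 1)))) by (field; lra).
      nra.
    + replace (p <=? s)%nat with true by (symmetry; apply Nat.leb_le; lia). simpl ind.
      assert (H := val_fact_deficit n p n Hp2' Hn (Nat.le_refl n)). lra.
  - assert (ln (INR n) * Rsum e1 (primes_to n) <= ln (INR n) * INR s)
      by (apply Rmult_le_compat_l; lra).
    assert (INR n * ln (INR n) * Rsum e2 (primes_to n) <= INR n * ln (INR n) * / INR s)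
      by (apply Rmult_le_compat_l; [apply Rmult_le_pos; lra|lra]).
    unfold Rdiv. lra.
Qed.

(** * Chebyshev bounds from binomial coefficients *)

Lemma theta_eq_filter m N :
  (m <= N)%nat -> theta m = Rsum (fun p => ln (INR p) * ind (p <=? m)%nat) (primes_to N).
Proof.
  intros H. induction N as [|N IH].
  - assert (m = 0)%nat as -> by lia. reflexivity.
  - destruct (Nat.eq_dec m (S N)) as [->|Hm].
    + apply Rsum_ext. intros p Hp. apply in_primes_to in Hp.
      replace (p <=? S N)%nat with true by (symmetry; apply Nat.leb_le; lia). simpl; lra.
    + rewrite Rsum_primes_S, <- IH by lia.
      replace (S N <=? m)%nat with false by (symmetry; apply Nat.leb_gt; lia).
      destruct (nat_primeb (S N)); simpl ind; lra.
Qed.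

Lemma theta_mono m n : (m <= n)%nat -> theta m <= theta n.
Proof. intros H. apply Rsum_primes_mono; auto. intros p _. apply ln_INR_nonneg. Qed.

(* Every prime in (b, a + b] divides the binomial coefficient (a + b)! / (a! b!). *)
Lemma theta_sub_le_ln_binomial a b :
  (a <= b)%nat -> theta (a + b) - theta b <= ln_fact (a + b) - ln_fact a - ln_fact b.
Proof.
  intros Hab. set (N := (a + b)%nat).
  destruct (Nat.eq_dec N 0) as [HN|HN].
  { unfold N in *. assert (a = 0)%nat by lia. assert (b = 0)%nat by lia. subst.
    unfold ln_fact, theta. simpl. lra. }
  rewrite (theta_eq_filter b N) by lia. unfold theta.
  rewrite (legendre N N N), (legendre N N a), (legendre N N b) by lia.
  rewrite <- !Rsum_minus. apply Rsum_le. intros p Hp.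
  apply in_primes_to in Hp. destruct Hp as [Hp HpN].
  assert (Hlp := ln_INR_prime_pos p Hp). assert (Hp2 := nat_prime_ge2 p Hp).
  assert (H : 1 - ind (p <=? b)%nat <= val_fact N p N - val_fact N p a - val_fact N p b);
    [|nra].
  assert (Hge : forall d, (1 <= d)%nat -> INR (a / d) + INR (b / d) <= INR (N / d)).
  { intros d Hd. rewrite <- plus_INR. apply le_INR. apply Nat.div_le_lower_bound; [lia|].
    pose proof (Nat.Div0.mul_div_le a d). pose proof (Nat.Div0.mul_div_le b d). unfold N. lia. }
  destruct N as [|N']; [lia|]. unfold val_fact. rewrite !Rsum_seq_shift.
  assert (Ht : 0 <= Rsum (fun k => INR (S N' / p ^ S k)) (seq 1 N')
     - Rsum (fun k => INR (a / p ^ S k)) (seq 1 N') - Rsum (fun k => INR (b / p ^ S k)) (seq 1 N')).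
  { rewrite <- !Rsum_minus. apply Rsum_nonneg. intros k _.
    assert (H := Hge (p ^ S k)%nat (pow_pos_nat p (S k) Hp2)). lra. }
  rewrite !Nat.pow_1_r. destruct (Nat.leb_spec p b) as [h|h]; simpl ind.
  - assert (H := Hge p ltac:(lia)). lra.
  (* A prime above [b >= a] and at most [a + b] divides the numerator and neither factorial of the
     denominator. *)
  - rewrite (Nat.div_small a p), (Nat.div_small b p) by lia.
    assert (H : (1 <= S N' / p)%nat) by (apply Nat.div_le_lower_bound; lia).
    apply INR_le_1 in H. change (INR 0) with 0. lra.
Qed.

(** The ratio of consecutive central binomial coefficients is [2 * (2 * n + 1) / (n + 1)]. *)
Lemma ln_binomial_even_step n :
  ln_fact (2 * S n) - 2 * ln_fact (S n) =
  ln_fact (2 * n) - 2 * ln_fact n + (ln (2 * INR n + 1) + ln 2 - ln (INR n + 1)).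
Proof.
  replace (2 * S n)%nat with (S (S (2 * n))) by lia. rewrite !ln_fact_S.
  assert (Hn := pos_INR n).
  replace (INR (S (S (2 * n)))) with (2 * (INR n + 1)) by (rewrite !S_INR, mult_INR; simpl; lra).
  replace (INR (S (2 * n))) with (2 * INR n + 1) by (rewrite !S_INR, mult_INR; simpl; lra).
  rewrite S_INR, ln_mult by lra. lra.
Qed.

Lemma ln_binomial_even_upper n : ln_fact (2 * n) - 2 * ln_fact n <= INR n * (2 * ln 2).
Proof.
  induction n as [|n IH].
  - unfold ln_fact; simpl; lra.
  - rewrite ln_binomial_even_step, S_INR. assert (Hn := pos_INR n).
    assert (ln (2 * INR n + 1) <= ln (2 * (INR n + 1))) by (apply ln_le_mono; lra).
    rewrite ln_mult in H by lra. lra.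
Qed.

Lemma ln_binomial_even_lower n :
  (1 <= n)%nat -> INR n * (2 * ln 2) - ln (2 * INR n) <= ln_fact (2 * n) - 2 * ln_fact n.
Proof.
  induction n as [|n IH]; [lia|intros _].
  rewrite ln_binomial_even_step. destruct (Nat.eq_dec n 0) as [->|Hn0].
  - unfold ln_fact. simpl. replace (2 * 0 + 1) with 1 by ring.
    replace (0 + 1) with 1 by ring. rewrite Rmult_1_r, ln_1. lra.
  - specialize (IH ltac:(lia)). assert (Hn := INR_le_1 n ltac:(lia)). rewrite S_INR.
    rewrite (ln_mult 2 (INR n + 1)) by lra. rewrite (ln_mult 2 (INR n)) in IH by lra.
    assert (H : ln (2 * (INR n)) <= ln (2 * INR n + 1)) by (apply ln_le_mono; lra).
    rewrite ln_mult in H by lra. lra.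
Qed.

Lemma ln_binomial_odd_upper n :
  ln_fact (2 * n + 1) - ln_fact n - ln_fact (n + 1) <= INR n * (2 * ln 2).
Proof.
  induction n as [|n IH].
  - unfold ln_fact; simpl. lra.
  - replace (2 * S n + 1)%nat with (S (S (2 * n + 1))) by lia.
    replace (S n + 1)%nat with (S (n + 1)) by lia. rewrite !ln_fact_S.
    replace (n + 1)%nat with (S n) in * by lia. assert (Hn := pos_INR n).
    replace (INR (S (S (2 * n + 1)))) with (2 * INR n + 3)
      by (rewrite !S_INR, plus_INR, mult_INR; simpl; lra).
    replace (INR (S (2 * n + 1))) with (2 * (INR n + 1))
      by (rewrite !S_INR, plus_INR, mult_INR; simpl; lra).
    replace (INR (S (S n))) with (INR n + 2) by (rewrite !S_INR; lra).
    rewrite S_INR, (ln_mult 2 (INR n + 1)) by lra.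
    assert (H : ln (2 * INR n + 3) <= ln (2 * (INR n + 2))) by (apply ln_le_mono; lra).
    rewrite ln_mult in H by lra. rewrite ln_fact_S, S_INR in IH.
    rewrite ?ln_fact_S, ?S_INR. lra.
Qed.

(** Chebyshev's bound by halving: [n = 2 * m] reduces to [m] through the central binomial
    coefficient, and [n = 2 * m + 1] to [m + 1] through the odd one, each at most [4 ^ m]. *)
Lemma theta_upper n : theta n <= INR n * (2 * ln 2).
Proof.
  assert (Hl2 : 0 < ln 2) by (rewrite <- ln_1; apply ln_increasing; lra).
  induction n as [n IH] using lt_wf_ind.
  destruct (le_lt_dec n 1) as [h|h].
  - assert (Hz : theta n = 0).
    { unfold theta. rewrite (Rsum_ext _ (fun _ => 0)); [rewrite Rsum_const; lra|].
      intros p Hp. apply in_primes_to in Hp. destruct Hp as [Hp Hq].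
      apply nat_prime_ge2 in Hp. lia. }
    rewrite Hz. assert (Hn := pos_INR n). nra.
  - destruct (Nat.Even_or_Odd n) as [[m ->]|[m ->]].
    + assert (H := theta_sub_le_ln_binomial m m (Nat.le_refl m)).
      replace (m + m)%nat with (2 * m)%nat in H by lia.
      assert (H1 := IH m ltac:(lia)). assert (H2 := ln_binomial_even_upper m).
      rewrite mult_INR. change (INR 2) with (1 + 1). lra.
    + assert (H := theta_sub_le_ln_binomial m (m + 1) ltac:(lia)).
      replace (m + (m + 1))%nat with (2 * m + 1)%nat in H by lia.
      assert (H1 := IH (m + 1)%nat ltac:(lia)). assert (H2 := ln_binomial_odd_upper m).
      rewrite plus_INR, mult_INR. rewrite plus_INR in H1.
      change (INR 2) with (1 + 1). change (INR 1) with 1 in *. lra.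
Qed.

(** For large [K], the integer part of the base [p] logarithm of [N]. *)
Definition pow_count (K p N : nat) : R := Rsum (fun k => ind (p ^ k <=? N)%nat) (seq 1 K).

Lemma pow_count_upper K p N :
  (2 <= p)%nat -> (1 <= N)%nat -> ln (INR p) * pow_count K p N <= ln (INR N).
Proof.
  intros Hp. assert (Hp' : 2 <= INR p) by (apply le_INR in Hp; simpl in Hp; lra).
  revert N; induction K as [|K IH]; intros N HN; unfold pow_count in *.
  - simpl. rewrite Rmult_0_r. apply ln_INR_nonneg.
  - rewrite Rsum_seq_shift, Nat.pow_1_r. destruct (Nat.leb_spec p N) as [h|h]; simpl ind.
    + assert (Hq : (1 <= N / p)%nat) by (apply Nat.div_le_lower_bound; lia).
      specialize (IH (N / p)%nat Hq).
      rewrite (Rsum_ext _ (fun k => ind (p ^ k <=? N / p)%nat)).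
      * assert (ln (INR (N / p)) + ln (INR p) <= ln (INR N)); [|lra].
        apply INR_le_1 in Hq.
        rewrite <- ln_mult by lra. apply ln_le_mono; [nra|].
        rewrite (INR_div_mod N p). assert (H := pos_INR (N mod p)). lra.
      * intros k _. f_equal. apply bool_iff_eq. rewrite !Nat.leb_le. simpl. split; intros H.
        -- apply Nat.div_le_lower_bound; lia.
        -- pose proof (Nat.Div0.mul_div_le N p). nia.
    + rewrite (Rsum_ext _ (fun _ => 0)).
      * rewrite Rsum_const. assert (H := ln_INR_nonneg N). lra.
      * intros k _. destruct (Nat.leb_spec (p * p ^ k) N) as [h'|h']; [|reflexivity].
        pose proof (pow_pos_nat p k Hp). nia.
Qed.

Lemma pow_count_le_1 K p N : (2 <= p)%nat -> (N < p * p)%nat -> pow_count K p N <= 1.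
Proof.
  intros Hp HN. unfold pow_count. destruct K as [|K]; [simpl; lra|].
  rewrite Rsum_seq_shift, (Rsum_ext _ (fun _ => 0)).
  - rewrite Rsum_const. destruct (p ^ 1 <=? N)%nat; simpl; lra.
  - intros k Hk. apply in_seq in Hk.
    destruct (Nat.leb_spec (p ^ S k) N) as [h|h]; [|reflexivity].
    destruct k as [|k]; [lia|]. simpl in h. pose proof (pow_pos_nat p k Hp). nia.
Qed.

(** Each power [p ^ k <= 2 * n] contributes at most 1 to the exponent of [p] in the central binomial
    coefficient. Hence the contribution of [p] is at most [ln (2 * n)], and at most [ln p] when
    [p > s], as then [p * p > 2 * n]. *)
Lemma ln_binomial_le_theta n s :
  (1 <= n)%nat -> (2 * n < (s + 1) * (s + 1))%nat ->
  ln_fact (2 * n) - 2 * ln_fact n <= theta (2 * n) + INR s * ln (2 * INR n).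
Proof.
  intros Hn Hs. set (N := (2 * n)%nat) in *.
  assert (HN : INR N = 2 * INR n) by (unfold N; rewrite mult_INR; simpl; lra).
  rewrite <- HN. assert (HlN := ln_INR_nonneg N).
  rewrite (legendre N N N), (legendre N N n) by lia. unfold theta.
  apply Rle_trans with (Rsum (fun p => ln (INR p) + ln (INR N) * ind (p <=? s)%nat) (primes_to N)).
  - rewrite <- Rsum_scal, <- Rsum_minus. apply Rsum_le. intros p Hp.
    apply in_primes_to in Hp. destruct Hp as [Hp HpN].
    assert (Hlp := ln_INR_prime_pos p Hp). assert (Hp2 := nat_prime_ge2 p Hp).
    assert (H : val_fact N p N - 2 * val_fact N p n <= pow_count N p N).
    { unfold val_fact, pow_count. rewrite <- Rsum_scal, <- Rsum_minus. apply Rsum_le.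
      intros k _. assert (Hd := pow_pos_nat p k Hp2). set (d := (p ^ k)%nat) in *.
      destruct (Nat.leb_spec d N) as [h|h]; simpl ind.
      - assert (H : (N / d <= 2 * (n / d) + 1)%nat).
        { apply Nat.lt_succ_r. apply Nat.Div0.div_lt_upper_bound.
          pose proof (Nat.mod_upper_bound n d ltac:(lia)). pose proof (Nat.div_mod_eq n d).
          unfold N. nia. }
        apply le_INR in H. rewrite plus_INR, mult_INR in H. simpl in H. lra.
      - rewrite (Nat.div_small N d) by lia. assert (H := pos_INR (n / d)).
        change (INR 0) with 0. lra. }
    destruct (Nat.leb_spec p s) as [h|h]; simpl ind.
    + assert (H1 := pow_count_upper N p N Hp2 ltac:(lia)). nra.
    + assert (H1 := pow_count_le_1 N p N Hp2 ltac:(nia)). nra.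
  - rewrite Rsum_plus, Rsum_scal.
    assert (Rsum (fun m => ind (m <=? s)%nat) (primes_to N) <= INR s).
    { apply Rle_trans with (2 := Rsum_ind_le N s). apply Rsum_primes_le_seq.
      intros k _. apply ind_nonneg. }
    nra.
Qed.

Lemma theta_even_lower n s :
  (1 <= n)%nat -> (2 * n < (s + 1) * (s + 1))%nat ->
  INR n * (2 * ln 2) - (INR s + 1) * ln (2 * INR n) <= theta (2 * n).
Proof.
  intros Hn Hs. assert (H1 := ln_binomial_even_lower n Hn).
  assert (H2 := ln_binomial_le_theta n s Hn Hs). lra.
Qed.

(** * Partial summation over primes *)

Definition ln_mertens_prod (n : nat) : R :=
  Rsum (fun p => - ln (1 - / INR p)) (primes_to n).

Definition prime_inv_sum (n : nat) : R := Rsum (fun p => / INR p) (primes_to n).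

(** This is what dividing the weights of [mertens_sum] by [ln p] produces; it stands between
    [mertens_sum] and [prime_inv_sum]. *)
Definition prime_pred_inv_sum (n : nat) : R := Rsum (fun p => / (INR p - 1)) (primes_to n).

Lemma ln_mertens_prod_mono m n : (m <= n)%nat -> ln_mertens_prod m <= ln_mertens_prod n.
Proof.
  intros H. apply Rsum_primes_mono; auto. intros p Hp. apply INR_prime_ge2 in Hp.
  assert (/ INR p <= / 2) by (apply Rinv_le_contravar; lra).
  assert (0 < / INR p) by (apply Rinv_0_lt_compat; lra).
  assert (ln (1 - / INR p) <= 1 - / INR p - 1) by (apply ln_le_sub_1; lra). lra.
Qed.

Lemma ln_pos_gt_1 x : 1 < x -> 0 < ln x.
Proof. intros H. rewrite <- ln_1. apply ln_increasing; lra. Qed.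

(* Discrete Abel summation against 1 / ln: the subtracted term makes every increment explicit. *)
Lemma prime_pred_inv_sum_step y :
  (1 <= y)%nat ->
  ln (ln (INR y + 2)) - ln (ln (INR y + 1)) + / ln (INR y + 2) - / ln (INR y + 1) <=
  (prime_pred_inv_sum (S y) - mertens_sum (S y) / ln (INR y + 2)) -
  (prime_pred_inv_sum y - mertens_sum y / ln (INR y + 1)).
Proof.
  intros Hy. assert (Hy' := INR_le_1 y Hy).
  assert (HA := mertens_sum_lower (S y) ltac:(lia)). rewrite S_INR in HA.
  replace (INR y + 1 + 1) with (INR y + 2) in HA by ring.
  set (L := ln (INR y + 1)) in *. set (L' := ln (INR y + 2)) in *.
  assert (HL : 0 < L) by (apply ln_pos_gt_1; lra).
  assert (HL' : L < L') by (apply ln_increasing; lra).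
  (* If [y + 1] is prime, its logarithm is [L]; otherwise both increments vanish. *)
  assert (Hs : prime_pred_inv_sum (S y) - prime_pred_inv_sum y =
               (mertens_sum (S y) - mertens_sum y) / L).
  { unfold prime_pred_inv_sum, mertens_sum. rewrite !Rsum_primes_S.
    destruct (nat_primeb (S y)); [|field; lra]. rewrite S_INR. fold L.
    field. lra. }
  assert (Hl : ln (L' / L) <= L' / L - 1) by (apply ln_le_sub_1, Rdiv_lt_0_compat; lra).
  rewrite ln_div in Hl by lra.
  assert (Hd : 0 <= / L - / L') by (apply (proj1 (Rminus_le_0 _ _)), Rinv_le_contravar; lra).
  (* The lower bound for [mertens_sum] enters with the nonnegative weight [1 / L - 1 / L']. *)
  apply (Rmult_le_compat_r (/ L - / L')) in HA; [|lra].
  replace ((L' - 1) * (/ L - / L')) with (L' / L - 1 - / L + / L') in HA by (field; lra).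
  replace (_ - (prime_pred_inv_sum y - mertens_sum y / L)) with
    (prime_pred_inv_sum (S y) - prime_pred_inv_sum y - mertens_sum (S y) / L' + mertens_sum y / L)
    by lra.
  rewrite Hs. unfold Rdiv in *. lra.
Qed.

(** The steps telescope from [x] to [y]. At [y] the boundary term is at least [1 - 1 / ln (y + 1)],
    which cancels the surviving [1 / ln (y + 1)]. *)
Lemma prime_pred_inv_sum_growth x y :
  (1 <= x)%nat -> (x <= y)%nat ->
  ln (ln (INR y + 1)) - ln (ln (INR x + 1)) + 1 - (mertens_sum x + 1) / ln (INR x + 1) <=
  prime_pred_inv_sum y - prime_pred_inv_sum x.
Proof.
  intros Hx Hxy.
  assert (H : ln (ln (INR y + 1)) - ln (ln (INR x + 1)) + / ln (INR y + 1) - / ln (INR x + 1) <=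
    (prime_pred_inv_sum y - mertens_sum y / ln (INR y + 1)) -
    (prime_pred_inv_sum x - mertens_sum x / ln (INR x + 1))).
  { induction Hxy as [|y Hxy IH]; [lra|].
    assert (H := prime_pred_inv_sum_step y ltac:(lia)). rewrite S_INR.
    replace (INR y + 1 + 1) with (INR y + 2) by ring. lra. }
  assert (Hy := mertens_sum_lower y ltac:(lia)).
  assert (Hy' := INR_le_1 y ltac:(lia)).
  assert (HL : 0 < ln (INR y + 1)) by (apply ln_pos_gt_1; lra).
  assert (H2 : 1 - / ln (INR y + 1) <= mertens_sum y / ln (INR y + 1)).
  { replace (1 - / ln (INR y + 1)) with ((ln (INR y + 1) - 1) / ln (INR y + 1)) by (field; lra).
    apply Rmult_le_compat_r; [left; now apply Rinv_0_lt_compat|lra]. }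
  unfold Rdiv in *. lra.
Qed.

(** Replacing [1 / (p - 1)] by [1 / p] costs at most the telescoping sum of [1 / (m - 1) - 1 / m]
    over all integers beyond [x]. *)
Lemma prime_inv_sum_growth x y :
  (1 <= x)%nat -> (x <= y)%nat ->
  ln (ln (INR y + 1)) - ln (ln (INR x + 1)) + 1 - (mertens_sum x + 1) / ln (INR x + 1) - / INR x <=
  prime_inv_sum y - prime_inv_sum x.
Proof.
  intros Hx Hxy. assert (H := prime_pred_inv_sum_growth x y Hx Hxy).
  assert (H2 : (prime_pred_inv_sum y - prime_pred_inv_sum x) - (prime_inv_sum y - prime_inv_sum x)
               <= / INR x - / INR y).
  { clear H. induction Hxy as [|y Hxy IH]; [lra|].
    unfold prime_pred_inv_sum, prime_inv_sum in *. rewrite !Rsum_primes_S.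
    assert (Hy := INR_le_1 y ltac:(lia)). rewrite S_INR.
    assert (Hd : 0 <= / INR y - / (INR y + 1)) by (apply (proj1 (Rminus_le_0 _ _)), Rinv_le_contravar; lra).
    replace (INR y + 1 - 1) with (INR y) by ring. destruct (nat_primeb (S y)); lra. }
  assert (Hy := INR_le_1 y ltac:(lia)).
  assert (0 < / INR y) by (apply Rinv_0_lt_compat; lra). lra.
Qed.

(** * Euler's constant and the Euler product *)

Lemma harmonic_S n : harmonic (S n) = harmonic n + / INR (S n).
Proof.
  assert (H : forall m, harmonic m = Rsum (fun k => / INR k) (seq 1 m)).
  { intros m. unfold harmonic. induction (seq 1 m) as [|a l IH]; simpl; [lra|].
    now rewrite IH. }
  rewrite !H. apply Rsum_seq_snoc.
Qed.

Lemma harmonic_sub_ln_decr n :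
  (1 <= n)%nat -> harmonic (S n) - ln (INR (S n)) <= harmonic n - ln (INR n).
Proof.
  intros Hn. apply INR_le_1 in Hn. rewrite harmonic_S, S_INR.
  assert (H : ln (INR n / (INR n + 1)) <= INR n / (INR n + 1) - 1)
    by (apply ln_le_sub_1, Rdiv_lt_0_compat; lra).
  rewrite ln_div in H by lra.
  replace (INR n / (INR n + 1) - 1) with (- / (INR n + 1)) in H by (field; lra). lra.
Qed.

Lemma harmonic_sub_ln_succ_incr m n :
  (m <= n)%nat -> harmonic m - ln (INR m + 1) <= harmonic n - ln (INR n + 1).
Proof.
  induction 1 as [|n _ IH]; [lra|]. rewrite harmonic_S, S_INR. assert (Hn := pos_INR n).
  assert (H : ln ((INR n + 1 + 1) / (INR n + 1)) <= (INR n + 1 + 1) / (INR n + 1) - 1)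
    by (apply ln_le_sub_1, Rdiv_lt_0_compat; lra).
  rewrite ln_div in H by lra.
  replace ((INR n + 1 + 1) / (INR n + 1) - 1) with (/ (INR n + 1)) in H by (field; lra). lra.
Qed.

(** The sequence [harmonic n - ln (n + 1)] increases and stays below the decreasing sequence that
    defines [euler_gamma]. *)
Lemma euler_gamma_lower m : harmonic m - ln (INR m + 1) <= euler_gamma.
Proof.
  set (u := fun n => harmonic n - ln (INR n)).
  assert (Hb : forall n, harmonic m - ln (INR m + 1) <= u (S n)).
  { intros n. apply Rle_trans with (harmonic (max m (S n)) - ln (INR (max m (S n)) + 1)).
    - apply harmonic_sub_ln_succ_incr. lia.
    - apply Rle_trans with (u (max m (S n))).
      + unfold u. assert (H := INR_le_1 (max m (S n)) ltac:(lia)).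
        assert (ln (INR (max m (S n))) <= ln (INR (max m (S n)) + 1))
          by (apply ln_le_mono; lra). lra.
      + assert (H : (S n <= max m (S n))%nat) by lia.
        induction H as [|k Hk IH]; [lra|].
        apply Rle_trans with (2 := IH). apply harmonic_sub_ln_decr. lia. }
  (* The decrease starts at index 1, hence the shift; the limit is the same. *)
  destruct (ex_finite_lim_seq_decr (fun n => u (S n)) (harmonic m - ln (INR m + 1))) as [l Hl].
  - intros n. apply harmonic_sub_ln_decr. lia.
  - exact Hb.
  - apply is_lim_seq_incr_1 in Hl as Hl'.
    unfold euler_gamma. fold u. rewrite (is_lim_seq_unique _ _ Hl'). simpl.
    apply (is_lim_seq_le (fun _ => harmonic m - ln (INR m + 1)) (fun n => u (S n))
      (Finite _) (Finite l)); auto. apply is_lim_seq_const.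
Qed.

(** * The Euler product at exponents above 1 *)

Definition inv_pow (s : R) (n : nat) : R := exp (- s * ln (INR n)).

Lemma inv_pow_1 s : inv_pow s 1 = 1.
Proof. unfold inv_pow. simpl. rewrite ln_1, Rmult_0_r. apply exp_0. Qed.

Lemma inv_pow_mul s a b :
  (1 <= a)%nat -> (1 <= b)%nat -> inv_pow s (a * b) = inv_pow s a * inv_pow s b.
Proof.
  intros Ha Hb. apply INR_le_1 in Ha. apply INR_le_1 in Hb.
  unfold inv_pow. rewrite mult_INR, ln_mult, <- exp_plus by lra. f_equal. ring.
Qed.

Lemma inv_pow_lt_1 s p : 0 < s -> (2 <= p)%nat -> inv_pow s p < 1.
Proof.
  intros Hs Hp. unfold inv_pow. rewrite <- exp_0. apply exp_increasing.
  apply le_INR in Hp. simpl in Hp. assert (0 < ln (INR p)) by (apply ln_pos_gt_1; lra). nra.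
Qed.

Lemma inv_pow_1_eq p : (1 <= p)%nat -> inv_pow 1 p = / INR p.
Proof.
  intros H. apply INR_le_1 in H. unfold inv_pow.
  replace (- (1) * ln (INR p)) with (- ln (INR p)) by ring. rewrite exp_Ropp, exp_ln; lra.
Qed.

Lemma inv_pow_split s t p : inv_pow (s + t) p = inv_pow s p * inv_pow t p.
Proof. unfold inv_pow. rewrite <- exp_plus. f_equal. ring. Qed.

(** A discrete integral comparison: the term at [m + 1] is at most
    [(m ^ (- d) - (m + 1) ^ (- d)) / d], and these bounds telescope. *)
Lemma zeta_partial_upper d n :
  0 < d -> Rsum (inv_pow (1 + d)) (seq 1 n) <= 1 + / d.
Proof.
  intros Hd. assert (Hd' : 0 < / d) by now apply Rinv_0_lt_compat.
  destruct n as [|n]; [simpl; lra|].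
  assert (H : Rsum (inv_pow (1 + d)) (seq 1 (S n)) <= 1 + / d * (1 - inv_pow d (S n))).
  { induction n as [|n IH].
    - simpl Rsum. rewrite !inv_pow_1. lra.
    - rewrite Rsum_seq_snoc. apply Rle_trans with (1 := Rplus_le_compat_r _ _ _ IH).
      rewrite inv_pow_split, inv_pow_1_eq by lia.
      set (m := S n). assert (Hm := INR_le_1 m ltac:(unfold m; lia)).
      assert (Hl : / INR (S m) <= ln (INR (S m)) - ln (INR m)).
      { rewrite S_INR. assert (H : ln (INR m / (INR m + 1)) <= INR m / (INR m + 1) - 1)
          by (apply ln_le_sub_1, Rdiv_lt_0_compat; lra).
        rewrite ln_div in H by lra.
        replace (INR m / (INR m + 1) - 1) with (- / (INR m + 1)) in H by (field; lra). lra. }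
      assert (He : inv_pow d m = inv_pow d (S m) * exp (d * (ln (INR (S m)) - ln (INR m)))).
      { unfold inv_pow. rewrite <- exp_plus. f_equal. ring. }
      assert (Hx := exp_ineq1_le (d * (ln (INR (S m)) - ln (INR m)))).
      assert (Hp : 0 < inv_pow d (S m)) by apply exp_pos.
      assert (H2 : inv_pow d (S m) * (d * / INR (S m)) <= inv_pow d m - inv_pow d (S m)).
      { rewrite He. assert (d * / INR (S m) <= d * (ln (INR (S m)) - ln (INR m)))
          by (apply Rmult_le_compat_l; lra). nra. }
      apply (Rmult_le_compat_l (/ d)) in H2; [|lra].
      replace (/ d * (inv_pow d (S m) * (d * / INR (S m)))) with
        (/ INR (S m) * inv_pow d (S m)) in H2 by (field; rewrite S_INR; lra). lra. }
  assert (0 < inv_pow d (S n)) by apply exp_pos. nra.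
Qed.

Definition rough (L : list nat) (X : nat) : list nat :=
  filter (fun n => forallb (fun q => negb (n mod q =? 0)%nat) L) (seq 1 X).

Lemma in_rough L X n :
  (forall q, In q L -> nat_prime q) ->
  (In n (rough L X) <-> (1 <= n <= X)%nat /\ forall q, In q L -> ~ Nat.divide q n).
Proof.
  intros HL. unfold rough. rewrite filter_In, in_seq, forallb_forall.
  assert (E : forall q, In q L -> (negb (n mod q =? 0)%nat = true <-> ~ Nat.divide q n)).
  { intros q Hq. apply HL, nat_prime_ge2 in Hq.
    rewrite <- (mod_eqb_divide n q) by lia. destruct (n mod q =? 0)%nat; simpl; intuition. }
  split; intros [H1 H2]; (split; [lia|]); intros q Hq; apply E; auto.
Qed.

(* Sieving a sum of a multiplicative function by the primes of L multiplies its supremum by the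
   factors 1 - f p; since n = 1 always survives, this bounds the Euler product. *)
Lemma rough_sum_upper (f : nat -> R) (Z : R) L :
  (forall n, 0 <= f n) ->
  (forall a b, (1 <= a)%nat -> (1 <= b)%nat -> f (a * b)%nat = f a * f b) ->
  (forall p, nat_prime p -> f p < 1) ->
  (forall X, Rsum f (seq 1 X) <= Z) ->
  NoDup L -> (forall q, In q L -> nat_prime q) ->
  forall X, Rsum f (rough L X) <= Z * exp (Rsum (fun p => ln (1 - f p)) L).
Proof.
  intros Hpos Hmul Hlt HZ. induction 1 as [|p L Hp Hnd IH]; intros HL X.
  - unfold rough. simpl. rewrite exp_0, Rmult_1_r.
    apply Rle_trans with (2 := HZ X). apply Rsum_incl; auto.
    + apply NoDup_filter, seq_NoDup.
    + intros n Hn. apply filter_In in Hn. tauto.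
  - assert (Hpp : nat_prime p) by (apply HL; now left).
    assert (HL' : forall q, In q L -> nat_prime q) by (intros; apply HL; now right).
    specialize (IH HL'). simpl. rewrite exp_plus, exp_ln by (specialize (Hlt p Hpp); lra).
    set (B := Z * exp (Rsum (fun p => ln (1 - f p)) L)) in *.
    replace (Z * ((1 - f p) * exp (Rsum (fun p => ln (1 - f p)) L))) with ((1 - f p) * B)
      by (unfold B; ring).
    set (W := Rsum f (rough (p :: L) X)). specialize (Hlt p Hpp). specialize (Hpos p) as Hp0.
    assert (Hp2 := nat_prime_ge2 p Hpp).
    (* Numbers free of [p] and [L] and the [p]-multiples of numbers free of [L] are disjoint
       families, and both are free of [L]. *)
    assert (Hstep : forall Y, W + f p * Rsum f (rough L Y) <= Rsum f (rough L (X + p * Y))).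
    { intros Y. unfold W. rewrite <- Rsum_scal.
      rewrite (Rsum_ext (fun k => f p * f k) (fun k => f (p * k)%nat)).
      2:{ intros k Hk. apply in_rough in Hk; auto. symmetry. apply Hmul; lia. }
      rewrite <- (Rsum_map f (Nat.mul p)), <- Rsum_app. apply Rsum_incl; auto.
      - apply NoDup_app.
        + apply NoDup_filter, seq_NoDup.
        + apply FinFun.Injective_map_NoDup; [intros a b; nia | apply NoDup_filter, seq_NoDup].
        + intros n Hn Hn2. apply in_rough in Hn; auto. apply in_map_iff in Hn2.
          destruct Hn2 as [m [<- _]]. apply (proj2 Hn p); [now left|].
          apply Nat.divide_factor_l.
      - intros n Hn. apply in_rough; auto. apply in_app_iff in Hn. destruct Hn as [Hn|Hn].
        + apply in_rough in Hn; auto. destruct Hn as [Hn1 Hn2]. split; [nia|].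
          intros q Hq. apply Hn2. now right.
        + apply in_map_iff in Hn. destruct Hn as [m [<- Hm]]. apply in_rough in Hm; auto.
          destruct Hm as [Hm1 Hm2]. split; [nia|]. intros q Hq Hd.
          destruct (nat_prime_divide_mul q p m (HL' q Hq) Hd) as [h|h].
          * apply nat_prime_divide_prime in h; auto. now subst.
          * now apply (Hm2 q). }
    (* Iterating the splitting sums a geometric series in [f p]; the limit in [i] then removes
       [f p ^ i]. *)
    assert (Hi : forall i, W * (1 - f p ^ i) <= (1 - f p) * B).
    { intros i. assert (exists Y, W * (1 - f p ^ i) <= (1 - f p) * Rsum f (rough L Y)) as [Y HY].
      { induction i as [|i [Y HY]].
        - exists 0%nat. simpl. lra.
        - exists (X + p * Y)%nat. specialize (Hstep Y). simpl pow.
          assert (f p * (W * (1 - f p ^ i)) <= f p * ((1 - f p) * Rsum f (rough L Y)))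
            by (apply Rmult_le_compat_l; lra).
          nra. }
      apply Rle_trans with (1 := HY). apply Rmult_le_compat_l; [lra|apply IH]. }
    assert (Hlim : is_lim_seq (fun i => W * (1 - f p ^ i)) W).
    { replace (Finite W) with (Rbar_mult W (1 - 0)) by (simpl; f_equal; ring).
      apply is_lim_seq_scal_l. apply is_lim_seq_minus'; [apply is_lim_seq_const|].
      apply is_lim_seq_geom. rewrite Rabs_pos_eq; lra. }
    apply (is_lim_seq_le _ (fun _ => (1 - f p) * B) (Finite W) (Finite ((1 - f p) * B)) Hi Hlim).
    apply is_lim_seq_const.
Qed.

(** The sieve bound is used at [X = 1]: the surviving term [f 1 = 1] is at most [(1 + 1 / d)] times
    the product of [1 - f p]. *)
Lemma euler_product_upper d y :
  0 < d -> Rsum (fun p => - ln (1 - inv_pow (1 + d) p)) (primes_to y) <= ln (1 + / d).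
Proof.
  intros Hd. assert (Hd' : 0 < / d) by now apply Rinv_0_lt_compat.
  set (f := inv_pow (1 + d)).
  assert (HL : forall q, In q (primes_to y) -> nat_prime q)
    by (intros q Hq; apply in_primes_to in Hq; tauto).
  assert (H := rough_sum_upper f (1 + / d) (primes_to y)).
  assert (H1 : 1 <= (1 + / d) * exp (Rsum (fun p => ln (1 - f p)) (primes_to y))).
  { apply Rle_trans with (Rsum f (rough (primes_to y) 1)).
    - assert (Hin : In 1%nat (rough (primes_to y) 1)).
      { apply in_rough; auto. split; [lia|]. intros q Hq Hdiv.
        apply HL, nat_prime_ge2 in Hq. apply Nat.divide_1_r in Hdiv. lia. }
      apply in_split in Hin. destruct Hin as [u [v ->]]. rewrite Rsum_app. simpl.
      unfold f at 2. rewrite inv_pow_1.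
      assert (0 <= Rsum f u) by (apply Rsum_nonneg; intros; left; apply exp_pos).
      assert (0 <= Rsum f v) by (apply Rsum_nonneg; intros; left; apply exp_pos). lra.
    - apply H; auto.
      + intros n. left. apply exp_pos.
      + intros a b. apply inv_pow_mul.
      + intros p Hp. apply inv_pow_lt_1; [lra|now apply nat_prime_ge2].
      + intros X. now apply zeta_partial_upper.
      + apply NoDup_primes_to. }
  apply ln_le_mono in H1; [|lra]. rewrite ln_1, ln_mult, ln_exp in H1; [|lra|apply exp_pos].
  rewrite (Rsum_ext _ (fun p => -1 * ln (1 - f p))) by (intros; fold f; ring).
  rewrite Rsum_scal. lra.
Qed.

(** * Mertens' third theorem *)

Definition log_series (r : R) (k : nat) : R := Rsum (fun j => r ^ j / INR j) (seq 1 k).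

Lemma log_series_S r k : log_series r (S k) = log_series r k + r ^ S k / INR (S k).
Proof. apply Rsum_seq_snoc. Qed.

Lemma log_series_le_harmonic r k : 0 <= r <= 1 -> log_series r k <= harmonic k.
Proof.
  intros Hr. induction k as [|k IH].
  - unfold log_series, harmonic. simpl. lra.
  - rewrite log_series_S, harmonic_S.
    assert (r ^ S k <= 1) by (rewrite <- (pow1 (S k)); apply pow_incr; lra).
    assert (0 < / INR (S k)) by (apply Rinv_0_lt_compat, lt_0_INR; lia).
    unfold Rdiv. nra.
Qed.

Lemma log_series_nonneg r k : 0 <= r -> 0 <= log_series r k.
Proof.
  intros Hr. apply Rsum_nonneg. intros j Hj. apply in_seq in Hj.
  apply Rdiv_le_0_compat; [now apply pow_le | apply lt_0_INR; lia].
Qed.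

(** Differentiating the partial sum gives a finite geometric series, so only the tail
    [- t ^ k / (1 - t)] is left. The mean value theorem turns this into the remainder bounds
    below. *)
Lemma is_derive_log_series k t :
  t < 1 -> is_derive (fun t => log_series t k + ln (1 - t)) t (- t ^ k / (1 - t)).
Proof.
  intros Ht. induction k as [|k IH].
  - unfold log_series. simpl. auto_derive; [lra|]. field. lra.
  - apply is_derive_ext with
      (fun t => (log_series t k + ln (1 - t)) + t ^ S k / INR (S k)).
    { intros s. rewrite log_series_S. lra. }
    assert (Hk : INR (S k) <> 0) by (apply not_0_INR; lia).
    replace (- t ^ S k / (1 - t)) with (- t ^ k / (1 - t) + t ^ k)
      by (simpl; field; lra).
    apply (is_derive_plus (V := R_NormedModule)); [exact IH|].
    auto_derive; auto. change (Init.Nat.pred (S k)) with k. field. auto.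
Qed.

Lemma log_series_bounds r k :
  0 < r < 1 -> - ln (1 - r) - r ^ k / (1 - r) <= log_series r k <= - ln (1 - r).
Proof.
  intros Hr.
  destruct (MVT_gen (fun t => log_series t k + ln (1 - t)) 0 r
    (fun t => - t ^ k / (1 - t))) as [c [Hc1 Hc2]].
  - intros t Ht. rewrite Rmin_left, Rmax_right in Ht by lra. apply is_derive_log_series. lra.
  - intros t Ht. rewrite Rmin_left, Rmax_right in Ht by lra.
    apply continuity_pt_filterlim.
    apply (ex_derive_continuous (fun t => log_series t k + ln (1 - t)) t).
    eexists. apply is_derive_log_series. lra.
  - rewrite Rmin_left, Rmax_right in Hc1 by lra.
    assert (Hz : log_series 0 k = 0).
    { unfold log_series. rewrite (Rsum_ext _ (fun _ => 0)); [rewrite Rsum_const; lra|].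
      intros j Hj. apply in_seq in Hj. rewrite pow_i by lia. unfold Rdiv. ring. }
    rewrite Hz, Rminus_0_r, ln_1 in Hc2.
    assert (Hck : c ^ k / (1 - c) <= r ^ k / (1 - r)).
    { apply Rmult_le_compat.
      - apply pow_le; lra.
      - left; apply Rinv_0_lt_compat; lra.
      - apply pow_incr; lra.
      - apply Rinv_le_contravar; lra. }
    assert (0 <= c ^ k / (1 - c)) by (apply Rdiv_le_0_compat; [apply pow_le|]; lra).
    assert (Heq : - c ^ k / (1 - c) * (r - 0) = - (r * (c ^ k / (1 - c)))) by (field; lra).
    nra.
Qed.

Lemma Rsum_primes_diff_le f g c m n :
  (m <= n)%nat ->
  (forall p, nat_prime p -> (m < p <= n)%nat -> c * g p <= f p) ->
  c * (Rsum g (primes_to n) - Rsum g (primes_to m)) <= Rsum f (primes_to n) - Rsum f (primes_to m).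
Proof.
  induction 1 as [|n Hmn IH]; intros H; [lra|].
  rewrite !Rsum_primes_S.
  assert (IH' := IH (fun p Hp Hr => H p Hp ltac:(lia))).
  destruct (nat_primeb (S n)) eqn:E; [|lra].
  apply nat_primeb_iff in E. specialize (H (S n) E ltac:(lia)). lra.
Qed.

Lemma exp_le_mono x y : x <= y -> exp x <= exp y.
Proof. intros [H|<-]; [left; now apply exp_increasing|lra]. Qed.

Lemma exp_pow_INR x m : exp x ^ m = exp (INR m * x).
Proof.
  induction m as [|m IH].
  - simpl. now rewrite Rmult_0_l, exp_0.
  - rewrite S_INR. simpl. rewrite IH, <- exp_plus. f_equal. ring.
Qed.

Lemma inv_pow_le_pow2 d p m :
  0 <= d -> (1 <= p)%nat -> (p <= 2 ^ m)%nat -> exp (- d * ln 2) ^ m <= inv_pow d p.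
Proof.
  intros Hd Hp Hpm.
  assert (H : ln (INR p) <= INR m * ln 2).
  { rewrite <- ln_pow by lra. apply ln_le_mono; [apply lt_0_INR; lia|].
    apply le_INR in Hpm. rewrite pow_INR in Hpm. simpl (INR 2) in Hpm. 
    replace (1 + 1) with 2 in Hpm by ring. exact Hpm. }
  rewrite exp_pow_INR. unfold inv_pow. apply exp_le_mono. nra.
Qed.

(** With [r = 2 ^ (- d)], a prime in the dyadic block ending at [2 ^ (j + 1)] has
    [p ^ (- d) >= r ^ (j + 1)]. The sums of [1 / p] up to block ends dominate harmonic numbers minus
    [C]. Abel summation with the decreasing weights [r ^ (j + 1)] turns harmonic numbers into the
    logarithmic series at [r]. *)
Lemma key_partial_sum d kap m0 k :
  0 < d -> (m0 <= k)%nat ->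
  (forall y, (2 ^ S m0 <= y)%nat ->
     ln (ln (INR y + 1)) - kap <= prime_inv_sum y - prime_inv_sum (2 ^ S m0)) ->
  exp (- d * ln 2) * log_series (exp (- d * ln 2)) k - (euler_gamma + kap - ln (ln 2)) <=
  Rsum (inv_pow (1 + d)) (primes_to (2 ^ S k)) - Rsum (inv_pow (1 + d)) (primes_to (2 ^ S m0)).
Proof.
  intros Hd Hk Hkap. set (r := exp (- d * ln 2)). set (C := euler_gamma + kap - ln (ln 2)).
  assert (Hl2 : 0 < ln 2) by (apply ln_pos_gt_1; lra).
  assert (Hr : 0 < r < 1).
  { split; [apply exp_pos|]. unfold r. rewrite <- exp_0. apply exp_increasing. nra. }
  set (b := fun k => prime_inv_sum (2 ^ S k) - prime_inv_sum (2 ^ S m0)).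
  (* At [y = 2 ^ (k + 1)] the iterated logarithm is at least [ln (k + 1) + ln (ln 2)], and
     [harmonic k <= ln (k + 1) + euler_gamma]. *)
  assert (Hb : forall k, (m0 <= k)%nat -> harmonic k - C <= b k).
  { intros i Hi.
    assert (H : (2 ^ S m0 <= 2 ^ S i)%nat) by (apply Nat.pow_le_mono_r; lia).
    specialize (Hkap _ H). fold (b i) in Hkap.
    assert (Hg := euler_gamma_lower i).
    assert (Hi' := pos_INR i).
    assert (Hln : (INR i + 1) * ln 2 <= ln (INR (2 ^ S i) + 1)).
    { rewrite <- S_INR, <- ln_pow by lra. apply ln_le_mono; [apply pow_lt; lra|].
      rewrite pow_INR. simpl (INR 2). replace (1 + 1) with 2 by ring. lra. }
    apply ln_le_mono in Hln; [|nra]. rewrite ln_mult in Hln by lra. unfold C. lra. }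
  (* Potential argument: the surplus b - (harmonic - C) is nonnegative and gets discounted. *)
  assert (H : r * log_series r k - C + r ^ S k * (b k - (harmonic k - C)) <=
    Rsum (inv_pow (1 + d)) (primes_to (2 ^ S k)) - Rsum (inv_pow (1 + d)) (primes_to (2 ^ S m0))).
  { induction Hk as [|k Hk IH].
    (* At [k = m0] the prime sum is empty, so [Hb] says [harmonic m0 <= C]. *)
    - rewrite Rminus_diag. assert (Hbm := Hb m0 (Nat.le_refl m0)).
      unfold b in *. rewrite Rminus_diag in *.
      assert (H1 := log_series_le_harmonic r m0 ltac:(lra)).
      assert (H2 := log_series_nonneg r m0 ltac:(lra)).
      assert (H3 : r ^ S m0 <= 1) by (rewrite <- (pow1 (S m0)); apply pow_incr; lra).
      assert (H4 : 0 < r ^ S m0) by (apply pow_lt; lra). nra.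
    - specialize (IH).
      assert (Hs := Rsum_primes_diff_le (inv_pow (1 + d)) (fun p => / INR p) (r ^ S (S k))
                (2 ^ S k) (2 ^ S (S k))).
      assert (H0 : (2 ^ S k <= 2 ^ S (S k))%nat) by (apply Nat.pow_le_mono_r; lia).
      specialize (Hs H0).
      assert (H1 : forall p, nat_prime p -> (2 ^ S k < p <= 2 ^ S (S k))%nat ->
        r ^ S (S k) * / INR p <= inv_pow (1 + d) p).
      { intros p Hp Hpr. apply nat_prime_ge2 in Hp. rewrite inv_pow_split, inv_pow_1_eq by lia.
        rewrite Rmult_comm. apply Rmult_le_compat_l.
        - left. apply Rinv_0_lt_compat, lt_0_INR. lia.
        - apply inv_pow_le_pow2; lia || lra. }
      specialize (Hs H1). fold (prime_inv_sum (2 ^ S (S k))) (prime_inv_sum (2 ^ S k)) in Hs.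
      replace (prime_inv_sum (2 ^ S (S k)) - prime_inv_sum (2 ^ S k)) with (b (S k) - b k) in Hs
        by (unfold b; lra).
      rewrite log_series_S, harmonic_S. specialize (Hb k Hk).
      replace (r ^ S (S k)) with (r * r ^ S k) in * by (simpl; ring).
      assert (0 < r ^ S k) by (apply pow_lt; lra).
      unfold Rdiv. set (q := / INR (S k)) in *. set (R := r ^ S k) in *.
      assert (0 <= (R - r * R) * (b k - (harmonic k - C))) by (apply Rmult_le_pos; nra).
      nra. }
  specialize (Hb k Hk). assert (0 < r ^ S k) by (apply pow_lt; lra). nra.
Qed.

(** Beyond [2 ^ S m0] each factor satisfies [- ln (1 - u) >= u], so [key_partial_sum] bounds that
    part of the Euler product from below. Letting [k] grow replaces the truncated series by
    [- ln (1 - r)]. *)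
Lemma key_fixed_exponent d kap m0 :
  0 < d ->
  (forall y, (2 ^ S m0 <= y)%nat ->
     ln (ln (INR y + 1)) - kap <= prime_inv_sum y - prime_inv_sum (2 ^ S m0)) ->
  Rsum (fun p => - ln (1 - inv_pow (1 + d) p)) (primes_to (2 ^ S m0))
    - exp (- d * ln 2) * ln (1 - exp (- d * ln 2)) - (euler_gamma + kap - ln (ln 2))
  <= ln (1 + / d).
Proof.
  intros Hd Hkap. set (r := exp (- d * ln 2)). set (C := euler_gamma + kap - ln (ln 2)).
  assert (Hl2 : 0 < ln 2) by (apply ln_pos_gt_1; lra).
  assert (Hr : 0 < r < 1).
  { split; [apply exp_pos|]. unfold r. rewrite <- exp_0. apply exp_increasing. nra. }
  set (F := fun p => - ln (1 - inv_pow (1 + d) p)).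
  assert (Hk : forall k, Rsum F (primes_to (2 ^ S m0))
     + r * (- ln (1 - r) - r ^ (k + m0) * / (1 - r)) - C <= ln (1 + / d)).
  { intros k. apply Rle_trans with (2 := euler_product_upper d (2 ^ S (k + m0)) Hd). fold F.
    assert (H := key_partial_sum d kap m0 (k + m0) Hd ltac:(lia) Hkap). fold r C in H.
    assert (Hls := proj1 (log_series_bounds r (k + m0) Hr)). unfold Rdiv in Hls.
    apply (Rmult_le_compat_l r) in Hls; [|lra].
    assert (Hd1 := Rsum_primes_diff_le F (inv_pow (1 + d)) 1 (2 ^ S m0) (2 ^ S (k + m0))).
    assert (H0 : (2 ^ S m0 <= 2 ^ S (k + m0))%nat) by (apply Nat.pow_le_mono_r; lia).
    specialize (Hd1 H0). assert (H1 : forall p, nat_prime p ->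
       (2 ^ S m0 < p <= 2 ^ S (k + m0))%nat -> 1 * inv_pow (1 + d) p <= F p).
    { intros p Hp _. unfold F.
      assert (Hlt := inv_pow_lt_1 (1 + d) p ltac:(lra) (nat_prime_ge2 p Hp)).
      assert (H2 := ln_le_sub_1 (1 - inv_pow (1 + d) p) ltac:(lra)). lra. }
    specialize (Hd1 H1). lra. }
  assert (Hlim : is_lim_seq (fun k => Rsum F (primes_to (2 ^ S m0))
     + r * (- ln (1 - r) - r ^ (k + m0) * / (1 - r)) - C)
     (Rsum F (primes_to (2 ^ S m0)) + r * (- ln (1 - r) - 0 * / (1 - r)) - C)).
  { apply is_lim_seq_minus'; [|apply is_lim_seq_const].
    apply is_lim_seq_plus'; [apply is_lim_seq_const|].
    apply (is_lim_seq_scal_l _ r (Finite (- ln (1 - r) - 0 * / (1 - r)))).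
    apply is_lim_seq_minus'; [apply is_lim_seq_const|].
    apply (is_lim_seq_scal_r _ (/ (1 - r)) (Finite 0)).
    apply (is_lim_seq_incr_n (fun k => r ^ k) m0).
    apply is_lim_seq_geom. rewrite Rabs_pos_eq; lra. }
  assert (H := is_lim_seq_le _ (fun _ => ln (1 + / d)) _ _ Hk Hlim (is_lim_seq_const _)).
  cbv beta iota delta [Rbar_le] in H. unfold Rdiv in *. lra.
Qed.

Lemma is_lim_seq_Rsum (F : nat -> nat -> R) (G : nat -> R) l :
  (forall p, In p l -> is_lim_seq (fun n => F n p) (G p)) ->
  is_lim_seq (fun n => Rsum (F n) l) (Rsum G l).
Proof.
  induction l as [|a l IH]; intros H; simpl.
  - apply is_lim_seq_const.
  - apply is_lim_seq_plus'; [apply H; now left | apply IH; intros; apply H; now right].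
Qed.

Lemma is_lim_seq_continuous_comp (f : R -> R) (u : nat -> R) l :
  continuous f l -> is_lim_seq u l -> is_lim_seq (fun n => f (u n)) (f l).
Proof.
  intros Hf Hu. apply (filterlim_comp _ _ _ u f _ _ _ Hu Hf).
Qed.

Lemma is_lim_seq_inv_S : is_lim_seq (fun n => / INR (S n)) 0.
Proof.
  apply (is_lim_seq_incr_1 (fun n => / INR n)).
  replace (Finite 0) with (Rbar_inv p_infty) by reflexivity.
  apply is_lim_seq_inv; [apply is_lim_seq_INR|discriminate].
Qed.

Lemma is_lim_seq_ln_div : is_lim_seq (fun n => ln (INR (S n)) / INR (S n)) 0.
Proof.
  apply (is_lim_seq_incr_1 (fun n => ln (INR n) / INR n)).
  apply (is_lim_comp_seq (fun y => ln y / y) INR p_infty 0 is_lim_div_ln_p).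
  - exists 0%nat. intros n _. discriminate.
  - apply is_lim_seq_INR.
Qed.

(** Take [d = 1 / (n + 1)]. Both [ln (1 + 1 / d)] and [- r * ln (1 - r)] grow like [ln (n + 1)];
    since [1 - r <= d * ln 2], these cancel up to [ln (ln 2)], which also occurs in the constant. *)
Lemma key_power_of_two kap m0 :
  (forall y, (2 ^ S m0 <= y)%nat ->
     ln (ln (INR y + 1)) - kap <= prime_inv_sum y - prime_inv_sum (2 ^ S m0)) ->
  ln_mertens_prod (2 ^ S m0) <= euler_gamma + kap.
Proof.
  intros Hkap.
  assert (Hl2 : 0 < ln 2) by (apply ln_pos_gt_1; lra).
  set (dl := fun n => / INR (S n)). set (r := fun n => exp (- dl n * ln 2)).
  set (F := fun n p => - ln (1 - inv_pow (1 + dl n) p)).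
  assert (Hn : forall n, Rsum (F n) (primes_to (2 ^ S m0)) <=
    (euler_gamma + kap - ln (ln 2)) + dl n + ln 2 * (ln (INR (S n)) / INR (S n)) + r n * ln (ln 2)).
  { intros n. assert (HN := INR_le_1 (S n) ltac:(lia)).
    assert (Hd : 0 < dl n) by (apply Rinv_0_lt_compat; lra).
    assert (H := key_fixed_exponent (dl n) kap m0 Hd Hkap).
    fold (r n) in H. fold (F n) in H.
    assert (Hr : 0 < r n < 1).
    { split; [apply exp_pos|]. unfold r. rewrite <- exp_0. apply exp_increasing. nra. }
    assert (H1 : 1 - r n <= dl n * ln 2)
      by (unfold r; pose proof (exp_ineq1_le (- dl n * ln 2)); lra).
    assert (H2 : ln (1 - r n) <= - ln (INR (S n)) + ln (ln 2)).
    { apply Rle_trans with (ln (dl n * ln 2)); [apply ln_le_mono; lra|].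
      rewrite ln_mult by lra. unfold dl. rewrite ln_Rinv by lra. lra. }
    assert (H3 : ln (1 + / dl n) <= ln (INR (S n)) + dl n).
    { unfold dl. rewrite Rinv_inv.
      replace (1 + INR (S n)) with (INR (S n) * (1 + / INR (S n))) by (field; lra).
      fold (dl n). rewrite ln_mult by lra. pose proof (ln_le_sub_1 (1 + dl n) ltac:(lra)). lra. }
    assert (H4 := ln_INR_nonneg (S n)).
    (* Replacing the factor [r] of the logarithm by 1 costs a term that tends to 0. *)
    assert (H5 : (1 - r n) * ln (INR (S n)) <= ln 2 * (ln (INR (S n)) / INR (S n))).
    { apply Rle_trans with (dl n * ln 2 * ln (INR (S n))); [nra|].
      unfold dl. right. field. lra. }
    nra. }
  assert (Hdl : is_lim_seq dl 0) by apply is_lim_seq_inv_S.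
  assert (Hr1 : is_lim_seq r 1).
  { unfold r. rewrite <- exp_0. replace 0 with (- 0 * ln 2) at 1 by ring.
    apply (is_lim_seq_continuous_comp (fun t => exp (- t * ln 2)) dl 0); auto.
    apply (ex_derive_continuous (V := R_NormedModule)). auto_derive. auto. }
  assert (Hlim1 : is_lim_seq (fun n => Rsum (F n) (primes_to (2 ^ S m0)))
                    (ln_mertens_prod (2 ^ S m0))).
  { apply is_lim_seq_Rsum. intros p Hp. apply in_primes_to in Hp. destruct Hp as [Hp _].
    assert (Hp2 := INR_prime_ge2 p Hp). assert (Hp2' := nat_prime_ge2 p Hp).
    rewrite <- inv_pow_1_eq by lia.
    replace (inv_pow 1 p) with (inv_pow (1 + 0) p) by (f_equal; ring).
    assert (Hlt := inv_pow_lt_1 (1 + 0) p ltac:(lra) Hp2').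
    apply (is_lim_seq_continuous_comp (fun t => - ln (1 - inv_pow (1 + t) p)) dl 0); auto.
    apply (ex_derive_continuous (V := R_NormedModule)). unfold inv_pow in *.
    auto_derive. lra. }
  assert (Hlim2 : is_lim_seq (fun n => (euler_gamma + kap - ln (ln 2)) + dl n
      + ln 2 * (ln (INR (S n)) / INR (S n)) + r n * ln (ln 2))
      ((euler_gamma + kap - ln (ln 2)) + 0 + ln 2 * 0 + 1 * ln (ln 2))).
  { apply is_lim_seq_plus'; [apply is_lim_seq_plus'; [apply is_lim_seq_plus'|]|].
    - apply is_lim_seq_const.
    - exact Hdl.
    - apply (is_lim_seq_scal_l _ (ln 2) (Finite 0)). apply is_lim_seq_ln_div.
    - apply (is_lim_seq_scal_r _ (ln (ln 2)) (Finite 1)). exact Hr1. }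
  assert (H := is_lim_seq_le _ _ _ _ Hn Hlim1 Hlim2). cbv beta iota delta [Rbar_le] in H. lra.
Qed.

(** The bound is first taken at a power of two [X >= x]. Returning to [x] removes at least [1 / p]
    for every prime in between, which absorbs the sum of [1 / p] included in the constant at [X]. *)
Lemma ln_mertens_prod_upper x :
  (2 <= x)%nat ->
  ln_mertens_prod x <= euler_gamma + ln (ln (INR x + 1))
    + (mertens_sum x + 1) / ln (INR x + 1) - 1 + / INR x.
Proof.
  intros Hx. set (kap := ln (ln (INR x + 1)) + (mertens_sum x + 1) / ln (INR x + 1) - 1 + / INR x).
  set (X := (2 ^ S x)%nat).
  assert (HX : (x <= X)%nat) 
    by (apply Nat.lt_le_incl, Nat.lt_trans with (S x); [lia|exact (pow_gt_exponent 2 (S x) (Nat.le_refl 2))]).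
  assert (H : ln_mertens_prod X <= euler_gamma + (kap + (prime_inv_sum X - prime_inv_sum x))).
  { apply key_power_of_two. fold X. intros y Hy.
    assert (H := prime_inv_sum_growth x y ltac:(lia) ltac:(lia)). unfold kap. lra. }
  assert (Hd := Rsum_primes_diff_le (fun p => - ln (1 - / INR p)) (fun p => / INR p) 1 x X HX).
  fold (ln_mertens_prod X) (ln_mertens_prod x) (prime_inv_sum X) (prime_inv_sum x) in Hd.
  assert (Hd' : 1 * (prime_inv_sum X - prime_inv_sum x) <= ln_mertens_prod X - ln_mertens_prod x).
  { apply Hd. intros p Hp _. apply INR_prime_ge2 in Hp.
    assert (/ INR p <= / 2) by (apply Rinv_le_contravar; lra).
    pose proof (ln_le_sub_1 (1 - / INR p) ltac:(lra)). lra. }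
  unfold kap in H. lra.
Qed.

(** * The divisor sum *)

Definition divisor_list (n : nat) : list nat :=
  filter (fun d => Nat.eqb (Nat.modulo n d) 0) (seq 1 n).

Lemma INR_sigma_div n : INR (sigma_div n) = Rsum INR (divisor_list n).
Proof.
  unfold sigma_div, divisor_list. induction (filter _ (seq 1 n)) as [|a l IH]; [reflexivity|].
  simpl. rewrite plus_INR, IH. reflexivity.
Qed.

Lemma in_divisor_list n d : (1 <= n)%nat -> (In d (divisor_list n) <-> Nat.divide d n).
Proof.
  intros Hn. unfold divisor_list. rewrite filter_In, in_seq. split.
  - intros [H1 H2]. apply mod_eqb_divide in H2; [auto|lia].
  - intros H. assert (Hd : (d <> 0)%nat) by (intros ->; apply Nat.divide_0_l in H; lia).
    assert (Hdn := Nat.divide_pos_le d n ltac:(lia) H).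
    split; [lia|]. apply mod_eqb_divide; [lia|auto].
Qed.

(** While [p] divides [d], cancel it; once it does not, [d] is coprime to [p] and Gauss's lemma
    discards the remaining powers. *)
Lemma divide_prime_power_mul p a m d :
  nat_prime p -> Nat.divide d (p ^ a * m) ->
  exists i e, (i <= a)%nat /\ Nat.divide e m /\ d = (p ^ i * e)%nat.
Proof.
  intros Hp. assert (Hp2 := nat_prime_ge2 p Hp). revert d.
  induction a as [|a IH]; intros d Hd.
  - exists 0%nat, d. simpl in *. rewrite Nat.add_0_r in Hd. repeat split; auto; lia.
  - destruct (Nat.eq_dec (d mod p) 0) as [h|h].
    + apply Nat.Lcm0.mod_divide in h. destruct h as [d' ->].
      destruct (IH d') as [i [e [Hi [He ->]]]].
      * simpl in Hd. rewrite <- Nat.mul_assoc, (Nat.mul_comm d') in Hd.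
        apply Nat.mul_divide_cancel_l in Hd; auto; lia.
      * exists (S i), e. repeat split; [lia|auto|simpl; lia].
    + assert (Hg : Nat.gcd d p = 1%nat).
      { destruct (Nat.gcd_divide d p) as [H1 H2].
        destruct (Nat.eq_dec (Nat.gcd d p) 1) as [E|E]; auto.
        assert (Hg0 : Nat.gcd d p <> 0%nat) by (intros E0; rewrite E0 in H2;
          apply Nat.divide_0_l in H2; lia).
        destruct (exists_prime_divisor (Nat.gcd d p) ltac:(lia)) as [q [Hq Hqd]].
        assert (q = p) by (apply nat_prime_divide_prime; auto; now apply Nat.divide_trans with (1 := Hqd)).
        subst q. exfalso. apply h, Nat.Lcm0.mod_divide. now apply Nat.divide_trans with (1 := Hqd). }
      simpl in Hd. rewrite <- Nat.mul_assoc in Hd. apply Nat.gauss in Hd; auto.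
      destruct (IH d Hd) as [i [e [Hi [He ->]]]]. exists i, e. repeat split; auto; lia.
Qed.

(** Every divisor of [p ^ a * m] occurs among the products [p ^ i * e]. An inequality suffices, so
    repetitions among them are allowed. *)
Lemma sigma_prime_power_mul p a m :
  nat_prime p -> (1 <= m)%nat ->
  INR (sigma_div (p ^ a * m)) <= Rsum (fun i => INR (p ^ i)) (seq 0 (S a)) * INR (sigma_div m).
Proof.
  intros Hp Hm. assert (Hp2 := nat_prime_ge2 p Hp).
  assert (Hpa : (1 <= p ^ a * m)%nat) by (pose proof (pow_pos_nat p a Hp2); nia).
  rewrite !INR_sigma_div.
  replace (Rsum (fun i => INR (p ^ i)) (seq 0 (S a)) * Rsum INR (divisor_list m)) with
    (Rsum INR (flat_map (fun i => map (Nat.mul (p ^ i)) (divisor_list m)) (seq 0 (S a)))).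
  - apply Rsum_incl.
    + apply NoDup_filter, seq_NoDup.
    + intros d Hd. apply in_divisor_list in Hd; auto.
      destruct (divide_prime_power_mul p a m d Hp Hd) as [i [e [Hi [He ->]]]].
      apply in_flat_map. exists i. split; [apply in_seq; lia|].
      apply in_map, in_divisor_list; auto.
    + intros k _. apply pos_INR.
  - rewrite Rsum_flat_map, Rmult_comm, <- Rsum_scal. apply Rsum_ext. intros i _.
    rewrite Rsum_map, (Rsum_ext _ (fun k => INR (p ^ i) * INR k)) by (intros; apply mult_INR).
    rewrite Rsum_scal. lra.
Qed.

Lemma Rsum_geometric p a :
  (INR p - 1) * Rsum (fun i => INR (p ^ i)) (seq 0 (S a)) = INR p ^ S a - 1.
Proof.
  induction a as [|a IH].
  - simpl. ring.
  - rewrite seq_snoc, Rsum_app, Rmult_plus_distr_l, IH.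
    replace (Rsum (fun i => INR (p ^ i)) ((0 + S a)%nat :: nil)) with (INR p ^ S a)
      by (cbn [Rsum fold_right Nat.add]; rewrite pow_INR; ring).
    simpl pow. ring.
Qed.

Lemma exists_prime_valuation p n :
  nat_prime p -> (1 <= n)%nat -> exists a m, n = (p ^ a * m)%nat /\ ~ Nat.divide p m /\ (1 <= m)%nat.
Proof.
  intros Hp. assert (Hp2 := nat_prime_ge2 p Hp).
  induction n as [n IH] using lt_wf_ind; intros Hn.
  destruct (Nat.eq_dec (n mod p) 0) as [h|h].
  - apply Nat.Lcm0.mod_divide in h. destruct h as [k ->].
    destruct (IH k ltac:(nia) ltac:(nia)) as [a [m [-> Hm]]].
    exists (S a), m. split; auto. simpl. lia.
  - exists 0%nat, n. repeat split; [simpl; lia| |auto].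
    intros Hd. apply h. now apply Nat.Lcm0.mod_divide.
Qed.

(** The logarithm of [q / (q - 1)], the supremum of [sigma (q ^ a) / q ^ a] over [a]. *)
Definition ln_factor (q : nat) : R := - ln (1 - / INR q).

Lemma exp_ln_factor q : (2 <= q)%nat -> exp (ln_factor q) = INR q / (INR q - 1).
Proof.
  intros Hq. apply le_INR in Hq. simpl in Hq.
  assert (/ INR q <= / 2) by (apply Rinv_le_contravar; lra).
  unfold ln_factor. rewrite exp_Ropp, exp_ln by lra. field. lra.
Qed.

(** The geometric sum gives [sigma (p ^ a) / p ^ a = (1 - p ^ (- (a + 1))) * p / (p - 1)]. The exact
    first factor and the surplus [(a - 1) * ln p] are recorded for later use at [p = 2]. *)
Lemma sigma_bound_step p a m L :
  nat_prime p -> ~ Nat.divide p m -> (1 <= m)%nat -> (1 <= a)%nat ->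
  NoDup L -> (forall q, In q L -> nat_prime q /\ Nat.divide q m) ->
  INR (sigma_div m) <= INR m * exp (Rsum ln_factor L) ->
  Rsum (fun q => ln (INR q)) L <= ln (INR m) ->
  let n := (p ^ a * m)%nat in
  NoDup (p :: L) /\ (forall q, In q (p :: L) -> nat_prime q /\ Nat.divide q n) /\
  INR (sigma_div n) <= INR n * (1 - / INR p ^ S a) * exp (Rsum ln_factor (p :: L)) /\
  INR (a - 1) * ln (INR p) + Rsum (fun q => ln (INR q)) (p :: L) <= ln (INR n).
Proof.
  intros Hp Hpm Hm Ha Hnd HL Hs Hl n.
  assert (Hp2 := nat_prime_ge2 p Hp). assert (HpR := INR_prime_ge2 p Hp).
  assert (Hm' := INR_le_1 m Hm).
  split; [|split; [intros q Hq; split|split]].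
  - constructor; auto. intros Hin. apply Hpm. now apply HL.
  - destruct Hq as [<-|Hq]; auto. now apply HL.
  - destruct Hq as [<-|Hq].
    + unfold n. exists (p ^ (a - 1) * m)%nat. replace a with (S (a - 1)) at 1 by lia. simpl. lia.
    + unfold n. apply Nat.divide_mul_r. now apply HL.
  - simpl Rsum. rewrite exp_plus, exp_ln_factor by auto.
    apply Rle_trans with (1 := sigma_prime_power_mul p a m Hp Hm).
    assert (Hg := Rsum_geometric p a). set (G := Rsum (fun i => INR (p ^ i)) (seq 0 (S a))) in *.
    assert (HG : G = (INR p ^ S a - 1) / (INR p - 1)) by (rewrite <- Hg; field; lra).
    assert (Hpow : 1 <= INR p ^ S a) by (apply pow_R1_Rle; lra).
    assert (HG0 : 0 <= G) by (rewrite HG; apply Rdiv_le_0_compat; lra).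
    apply Rle_trans with (G * (INR m * exp (Rsum ln_factor L))); [now apply Rmult_le_compat_l|].
    right. rewrite HG. unfold n. rewrite mult_INR, pow_INR. simpl pow. field.
    repeat split; try lra. apply pow_nonzero; lra.
  - simpl Rsum. unfold n. rewrite mult_INR, pow_INR, ln_mult, ln_pow; try lra.
    + rewrite minus_INR by auto. simpl INR. lra.
    + apply pow_lt; lra.
Qed.

Lemma sigma_bound n :
  (1 <= n)%nat ->
  exists L, NoDup L /\ (forall q, In q L -> nat_prime q /\ Nat.divide q n) /\
    INR (sigma_div n) <= INR n * exp (Rsum ln_factor L) /\
    Rsum (fun q => ln (INR q)) L <= ln (INR n).
Proof.
  induction n as [n IH] using lt_wf_ind; intros Hn.
  destruct (Nat.eq_dec n 1) as [->|Hn1].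
  - exists nil. split; [constructor|split; [easy|split]].
    + simpl. rewrite exp_0. lra.
    + simpl. rewrite ln_1. lra.
  - destruct (exists_prime_divisor n ltac:(lia)) as [p [Hp Hpn]].
    assert (Hp2 := nat_prime_ge2 p Hp). assert (HpR := INR_prime_ge2 p Hp).
    destruct (exists_prime_valuation p n Hp Hn) as [a [m [E [Hpm Hm]]]].
    assert (Ha : (1 <= a)%nat).
    { destruct a; [|lia]. simpl in E. rewrite Nat.add_0_r in E. now subst. }
    assert (Hmn : (m < n)%nat).
    { destruct a as [|a]; [lia|]. simpl in E. pose proof (pow_pos_nat p a Hp2).
      assert (2 <= p * p ^ a)%nat by nia. rewrite E. clear - H0 Hm. nia. }
    destruct (IH m Hmn Hm) as [L [H1 [H2 [H3 H4]]]].
    destruct (sigma_bound_step p a m L) as [G1 [G2 [G3 G4]]]; auto. rewrite <- E in *.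
    exists (p :: L). split; [auto|split; [auto|split]].
    + apply Rle_trans with (1 := G3). apply Rmult_le_compat_r; [left; apply exp_pos|].
      assert (0 < / INR p ^ S a) by (apply Rinv_0_lt_compat, pow_lt; lra).
      assert (Hn' := pos_INR n).
      assert (0 <= INR n * / INR p ^ S a) by (apply Rmult_le_pos; lra). lra.
    + assert (0 <= INR (a - 1) * ln (INR p)) by
        (apply Rmult_le_pos; [apply pos_INR | apply ln_INR_nonneg]). lra.
Qed.

Lemma sigma_bound_even n :
  (1 <= n)%nat -> Nat.divide 2 n ->
  exists a L, (1 <= a)%nat /\ NoDup L /\ (forall q, In q L -> nat_prime q /\ Nat.divide q n) /\
    INR (sigma_div n) <= INR n * (1 - / 2 ^ S a) * exp (Rsum ln_factor L) /\
    INR (a - 1) * ln 2 + Rsum (fun q => ln (INR q)) L <= ln (INR n).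
Proof.
  intros Hn H2. assert (Hp : nat_prime 2) by exact prime_2.
  destruct (exists_prime_valuation 2 n Hp Hn) as [a [m [E [Hpm Hm]]]].
  assert (Ha : (1 <= a)%nat).
  { destruct a; [|lia]. simpl in E. rewrite Nat.add_0_r in E. now subst. }
  destruct (sigma_bound m Hm) as [L [H1 [H3 [H4 H5]]]].
  destruct (sigma_bound_step 2 a m L) as [G1 [G2 [G3 G4]]]; auto. rewrite <- E in *.
  exists a, (2%nat :: L). change (INR 2) with 2 in *. auto.
Qed.

(** * Comparison with the smallest primes *)

(** After subtracting the constant [f x], members of [L] above [x] count at most 0 and primes up to
    [x] at least 0. Equal lengths cancel the constant. *)
Lemma Rsum_primes_exchange f L x :
  NoDup L -> (forall q, In q L -> nat_prime q) -> length L = length (primes_to x) -> (2 <= x)%nat ->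
  (forall a b, (2 <= a)%nat -> (a <= b)%nat -> f b <= f a) ->
  Rsum f L <= Rsum f (primes_to x).
Proof.
  intros Hnd HL Hlen Hx Hf.
  assert (H : Rsum (fun q => f q - f x) L <= Rsum (fun q => f q - f x) (primes_to x)).
  { apply Rle_trans with (Rsum (fun q => f q - f x) (filter (fun q => q <=? x)%nat L)).
    - rewrite Rsum_filter. apply Rsum_le. intros q Hq. destruct (Nat.leb_spec q x); [lra|].
      assert (f q <= f x) by (apply Hf; lia). lra.
    - apply Rsum_incl.
      + now apply NoDup_filter.
      + intros q Hq. apply filter_In in Hq. destruct Hq as [Hq1 Hq2].
        apply Nat.leb_le in Hq2. apply in_primes_to. auto.
      + intros q Hq. apply in_primes_to in Hq. destruct Hq as [Hq1 Hq2].
        apply nat_prime_ge2 in Hq1. assert (f x <= f q) by (apply Hf; lia). lra. }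
  rewrite !Rsum_minus, !Rsum_const, Hlen in H. lra.
Qed.

Lemma exists_prime_count s m :
  (s <= length (primes_to m))%nat -> exists x, length (primes_to x) = s.
Proof.
  induction m as [|m IH]; intros H.
  - exists 0%nat. simpl in *. lia.
  - destruct (le_lt_dec s (length (primes_to m))) as [h|h]; [auto|].
    exists (S m). rewrite primes_to_S, length_app in *.
    destruct (nat_primeb (S m)); simpl in *; lia.
Qed.

Lemma list_bounded (L : list nat) : exists m, forall q, In q L -> (q <= m)%nat.
Proof.
  exists (list_max L). apply Forall_forall, list_max_le. lia.
Qed.

(** The bound [x] depends only on the length of [L], so one [x] serves both the decreasing
    [ln_factor] and, after a change of sign, [ln]. *)
Lemma primes_list_compare L :
  NoDup L -> (forall q, In q L -> nat_prime q) -> L <> nil ->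
  exists x, (2 <= x)%nat /\ Rsum ln_factor L <= ln_mertens_prod x /\
    theta x <= Rsum (fun q => ln (INR q)) L.
Proof.
  intros Hnd HL Hnil. destruct (list_bounded L) as [m Hm].
  destruct (exists_prime_count (length L) m) as [x Hx].
  { apply NoDup_incl_length; auto. intros q Hq. apply in_primes_to. auto. }
  assert (Hx2 : (2 <= x)%nat).
  { destruct (le_lt_dec 2 x) as [h|h]; auto. exfalso.
    destruct L as [|q L]; [tauto|]. destruct (primes_to x) as [|p l] eqn:E; [discriminate|].
    assert (Hin : In p (primes_to x)) by (rewrite E; now left).
    apply in_primes_to in Hin. destruct Hin as [Hp Hpx]. apply nat_prime_ge2 in Hp. lia. }
  exists x. repeat split; auto.
  - apply Rsum_primes_exchange; auto. intros a b Ha Hab. unfold ln_factor.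
    apply le_INR in Ha. apply le_INR in Hab. simpl in Ha.
    assert (/ INR a <= / 2) by (apply Rinv_le_contravar; lra).
    assert (/ INR b <= / INR a) by (apply Rinv_le_contravar; lra).
    apply Ropp_le_contravar, ln_le_mono; lra.
  - assert (H : Rsum (fun q => -1 * ln (INR q)) L <= Rsum (fun q => -1 * ln (INR q)) (primes_to x)).
    { apply Rsum_primes_exchange; auto. intros a b Ha Hab.
      assert (ln (INR a) <= ln (INR b)); [|lra].
      apply ln_le_mono; [apply lt_0_INR; lia|now apply le_INR]. }
    rewrite !Rsum_scal in H. unfold theta. lra.
Qed.

(** The comparison is made for [p :: L], and the factor [p / (p - 1)] is then moved across. The
    number [c] carries a surplus in [ln n], such as that of a high power of 2. *)
Lemma primes_list_compare_avoiding p n L c :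
  nat_prime p -> (p <= 5)%nat -> ~ Nat.divide p n ->
  NoDup L -> (forall q, In q L -> nat_prime q /\ Nat.divide q n) ->
  c + Rsum (fun q => ln (INR q)) L <= ln (INR n) ->
  exists x, (2 <= x)%nat /\
    exp (Rsum ln_factor L) <= (1 - / INR p) * exp (ln_mertens_prod x) /\
    c + theta x - ln 5 <= ln (INR n).
Proof.
  intros Hp Hp5 Hpn Hnd HL Hn. assert (HpR := INR_prime_ge2 p Hp).
  destruct (primes_list_compare (p :: L)) as [x [Hx [H1 H2]]].
  - constructor; auto. intros Hin. now apply Hpn, HL.
  - intros q [<-|Hq]; auto. now apply HL.
  - discriminate.
  - exists x. split; auto. simpl Rsum in *. split.
    + assert (H : exp (ln_factor p + Rsum ln_factor L) <= exp (ln_mertens_prod x))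
        by now apply exp_le_mono.
      rewrite exp_plus, exp_ln_factor in H by now apply nat_prime_ge2.
      assert (H3 : 0 < 1 - / INR p).
      { assert (/ INR p <= / 2) by (apply Rinv_le_contravar; lra). lra. }
      apply (Rmult_le_compat_l (1 - / INR p)) in H; [|lra].
      replace ((1 - / INR p) * (INR p / (INR p - 1) * exp (Rsum ln_factor L)))
        with (exp (Rsum ln_factor L)) in H by (field; lra). exact H.
    + assert (ln (INR p) <= ln 5).
      { apply ln_le_mono; [lra|]. apply le_INR in Hp5. simpl in Hp5. lra. }
      lra.
Qed.

(** * Large arguments *)

(** The logarithmic series at [1 / 2] with 16 terms has error at most [2 ^ (- 15)]. *)
Lemma ln_2_bounds : 0.6931 < ln 2 < 0.6932.
Proof.
  destruct (log_series_bounds (/ 2) 16 ltac:(lra)) as [H1 H2].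
  replace (1 - / 2) with (/ 2) in * by lra. rewrite ln_Rinv in * by lra.
  unfold log_series in *. rewrite (Rsum_ext _ (fun j => (/ 2) ^ j / IZR (Z.of_nat j))) in *
    by (intros; now rewrite INR_IZR_INZ).
  cbn [seq Rsum fold_right Z.of_nat Pos.of_succ_nat Pos.succ pow] in *. lra.
Qed.

Lemma exp_upper_square a : 0 <= a < 2 -> exp a <= / (1 - a / 2) ^ 2.
Proof.
  intros Ha. assert (H := exp_ineq1_le (- (a / 2))).
  replace (exp a) with (/ exp (- (a / 2)) ^ 2).
  - apply Rinv_le_contravar; [apply pow_lt; lra|]. apply pow_incr. lra.
  - rewrite exp_pow_INR, <- exp_Ropp. f_equal. simpl. field.
Qed.

(** Here 181 is the integer square root of [2 ^ 15]; the linear bound from the tangent below is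
    tightest there. *)
Lemma ln_le_sqrt s x :
  (181 <= s)%nat -> (x < (s + 1) * (s + 1))%nat -> (1 <= x)%nat -> ln (INR x) <= 0.0584 * INR s.
Proof.
  intros Hs Hx Hx1. apply le_INR in Hs. rewrite INR_IZR_INZ in Hs. simpl IZR in Hs.
  assert (Hl2 := ln_2_bounds).
  assert (H1 : ln (INR x) <= 2 * ln (INR s + 1)).
  { replace (2 * ln (INR s + 1)) with (ln ((INR s + 1) * (INR s + 1)))
      by (rewrite ln_mult by lra; ring).
    apply ln_le_mono; [apply lt_0_INR; lia|].
    apply Nat.lt_le_incl, le_INR in Hx. rewrite mult_INR, plus_INR in Hx. exact Hx. }
  (* tangent of ln at 128 = 2 ^ 7 *)
  assert (H2 : ln (INR s + 1) <= 7 * ln 2 + ((INR s + 1) / 128 - 1)).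
  { assert (H := ln_le_sub_1 ((INR s + 1) / 128) ltac:(lra)).
    rewrite ln_div in H by lra. replace 128 with (2 ^ 7) in H at 1 by ring.
    rewrite ln_pow in H by lra. simpl INR in H. lra. }
  lra.
Qed.

Lemma sqrt_nat_bounds x :
  (32768 <= Z.of_nat x)%Z -> let s := Nat.sqrt x in
  (181 <= s)%nat /\ (s * s <= x)%nat /\ (x < (s + 1) * (s + 1))%nat.
Proof.
  intros Hx s. assert (H := Nat.sqrt_spec x ltac:(lia)). fold s in H.
  split; [|split]; [|lia|lia]. apply Nat.sqrt_le_square. lia.
Qed.

(** With [s] the integer square root of [x], both error terms are at most [0.0584 * x]. The constant
    rounds up [- 1 + 2 * ln 2 + 2 * 0.0584] plus terms of order [ln x / x]. *)
Lemma mertens_sum_le_large x :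
  (32768 <= Z.of_nat x)%Z -> mertens_sum x <= ln (INR x) + 0.505.
Proof.
  intros Hx. destruct (sqrt_nat_bounds x Hx) as [Hs1 [Hs2 Hs3]]. set (s := Nat.sqrt x) in *.
  assert (Ht := ln_le_sqrt s x Hs1 Hs3 ltac:(lia)).
  assert (H := mertens_sum_upper x s ltac:(lia) ltac:(lia)).
  assert (Hf := ln_fact_upper x ltac:(lia)). assert (Hth := theta_upper x).
  assert (Hl2 := ln_2_bounds).
  assert (HxR : 32768 <= INR x) by (rewrite INR_IZR_INZ; now apply IZR_le).
  assert (HsR : 181 <= INR s) by (rewrite INR_IZR_INZ; apply IZR_le; lia).
  assert (Hss : INR s * INR s <= INR x) by (rewrite <- mult_INR; now apply le_INR).
  set (t := ln (INR x)) in *. assert (Ht0 : 0 <= t) by apply ln_INR_nonneg.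
  assert (H1 : INR s * t <= 0.0584 * INR x) by nra.
  assert (H2 : INR x * t / INR s <= 0.0584 * INR x).
  { apply Rle_div_l; [lra|]. nra. }
  assert (H3 : t <= 0.0004 * INR x) by nra.
  apply Rmult_le_reg_l with (INR x); [lra|]. nra.
Qed.

(** The target [(x + 1) / 2] is chosen to have logarithm [ln (x + 1) - ln 2]. *)
Lemma theta_lower_large x :
  (32768 <= Z.of_nat x)%Z -> (INR x + 1) / 2 <= theta x - ln 5.
Proof.
  intros Hx. destruct (sqrt_nat_bounds x Hx) as [Hs1 [Hs2 Hs3]]. set (s := Nat.sqrt x) in *.
  assert (Ht := ln_le_sqrt s x Hs1 Hs3 ltac:(lia)).
  assert (Hl2 := ln_2_bounds).
  assert (HxR : 32768 <= INR x) by (rewrite INR_IZR_INZ; now apply IZR_le).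
  assert (HsR : 181 <= INR s) by (rewrite INR_IZR_INZ; apply IZR_le; lia).
  assert (Hss : INR s * INR s <= INR x) by (rewrite <- mult_INR; now apply le_INR).
  set (n := Nat.div2 x). assert (Hn := Nat.div2_odd x). fold n in Hn.
  assert (Hn2 : (2 * n <= x /\ x <= 2 * n + 1)%nat) by (destruct (Nat.odd x); simpl in Hn; lia).
  assert (H := theta_even_lower n s ltac:(lia) ltac:(lia)).
  assert (Hm := theta_mono (2 * n) x ltac:(lia)).
  assert (HnR : INR x - 1 <= 2 * INR n <= INR x).
  { destruct Hn2 as [h1 h2]. apply le_INR in h1. apply le_INR in h2.
    rewrite plus_INR, mult_INR in *. simpl in h1, h2. lra. }
  assert (Hln : ln (2 * INR n) <= ln (INR x)) by (apply ln_le_mono; lra).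
  set (t := ln (INR x)) in *. set (t' := ln (2 * INR n)) in *.
  assert (Ht0 : 0 <= t) by apply ln_INR_nonneg.
  assert (H5 : ln 5 <= 4) by (assert (h := ln_le_sub_1 5 ltac:(lra)); lra).
  assert (H1 : (INR s + 1) * t' <= (INR s + 1) * (0.0584 * INR s))
    by (apply Rmult_le_compat_l; lra).
  assert (H2 : (INR s + 1) * (0.0584 * INR s) <= 0.06 * INR x) by nra.
  assert (H3 : INR n * (2 * ln 2) >= 0.693 * (INR x - 1)) by nra.
  lra.
Qed.

(** In terms of [L = ln (x + 1) >= 15 * ln 2], the left side is at most [0.93 * exp gamma * L], as
    [4 / 5 * 1.1625 = 0.93], while [L - ln 2 > 0.93 * L]. *)
Lemma mertens_prod_large x :
  (32768 <= Z.of_nat x)%Z ->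
  4 / 5 * exp (ln_mertens_prod x) < exp euler_gamma * ln (theta x - ln 5).
Proof.
  intros Hx. assert (HA := mertens_sum_le_large x Hx). assert (Hth := theta_lower_large x Hx).
  assert (Hl2 := ln_2_bounds).
  assert (HxR : 32768 <= INR x) by (rewrite INR_IZR_INZ; now apply IZR_le).
  assert (HP := ln_mertens_prod_upper x ltac:(lia)).
  set (L := ln (INR x + 1)) in *.
  assert (HL : 10.396 <= L).
  { apply Rle_trans with (ln (2 ^ 15)); [rewrite ln_pow by lra; simpl INR; lra|].
    apply ln_le_mono; [apply pow_lt|]; lra. }
  assert (Ht : ln (INR x) <= L) by (apply ln_le_mono; lra).
  assert (Hinv : / INR x <= 0.0001) by
    (apply Rle_trans with (/ 32768); [apply Rinv_le_contravar; lra|lra]).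
  assert (He : (mertens_sum x + 1) / L - 1 + / INR x <= 0.1450).
  { assert ((mertens_sum x + 1) / L <= 1.1448); [|lra]. apply Rle_div_l; lra. }
  assert (H1 : exp (ln_mertens_prod x) <= exp euler_gamma * L * exp 0.1450).
  { replace (exp euler_gamma * L * exp 0.1450) with (exp (euler_gamma + ln L + 0.1450))
      by (rewrite !exp_plus, exp_ln by lra; reflexivity).
    apply exp_le_mono. lra. }
  assert (H2 : exp 0.1450 <= 1.1625).
  { apply Rle_trans with (1 := exp_upper_square 0.1450 ltac:(lra)). lra. }
  assert (H3 : L - ln 2 <= ln (theta x - ln 5)).
  { unfold L. rewrite <- ln_div by lra. apply ln_le_mono; lra. }
  assert (Hg := exp_pos euler_gamma).
  apply Rle_lt_trans with (4 / 5 * (exp euler_gamma * L * 1.1625)).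
  - apply Rmult_le_compat_l; [lra|]. apply Rle_trans with (1 := H1).
    apply Rmult_le_compat_l; nra.
  - apply Rlt_le_trans with (exp euler_gamma * (L - ln 2)); [nra|].
    apply Rmult_le_compat_l; lra.
Qed.

(** * Computation *)

Definition harmonic_scan (n : nat) : Z :=
  fold_right (fun k s => 1000000 / Z.of_nat k + s)%Z 0%Z (seq 1 n).

Lemma harmonic_scan_le n : IZR (harmonic_scan n) <= 1000000 * harmonic n.
Proof.
  unfold harmonic_scan, harmonic.
  assert (H : forall k, In k (seq 1 n) -> (1 <= k)%nat) by (intros k Hk; apply in_seq in Hk; lia).
  induction (seq 1 n) as [|k l IH]; [simpl; lra|].
  assert (Hk := H k (or_introl eq_refl)). cbn [fold_right map]. rewrite plus_IZR.
  assert (IH' := IH (fun j Hj => H j (or_intror Hj))).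
  assert (IZR (1000000 / Z.of_nat k) <= 1000000 * / INR k); [|lra].
  apply INR_le_1 in Hk as HkR. apply Rle_div_r; [lra|].
  rewrite INR_IZR_INZ, <- mult_IZR. apply IZR_le.
  pose proof (Z.mul_div_le 1000000 (Z.of_nat k) ltac:(lia)). lia.
Qed.

(** At 127 the logarithm is [ln (2 ^ 7)], so the bounds on [ln 2] suffice to get [gamma >= 0.572];
    five Taylor terms of [exp] beyond the constant finish. *)
Lemma exp_euler_gamma_lower : 1.77 < exp euler_gamma.
Proof.
  assert (H := euler_gamma_lower 127). assert (Hs := harmonic_scan_le 127).
  replace (harmonic_scan 127) with 5425283%Z in Hs by (vm_compute; reflexivity).
  replace (INR 127 + 1) with (2 ^ 7) in H by (rewrite INR_IZR_INZ; simpl; lra).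
  rewrite ln_pow in H by lra. assert (Hl2 := ln_2_bounds). simpl (INR 7) in H.
  apply Rlt_le_trans with (exp 0.572).
  - apply Rlt_le_trans with (2 := exp_ge_taylor 0.572 5 ltac:(lra)).
    simpl. lra.
  - apply exp_le_mono. lra.
Qed.

(** * Primality by trial division *)

(* The primes below 183, which suffice to test numbers below 183 ^ 2 = 33489. *)
Definition trial_divisors : list Z :=
  Eval vm_compute in
    filter (fun d => forallb (fun e => (d <=? e) || negb (d mod e =? 0))%Z%bool
                       (2 :: 3 :: 5 :: 7 :: 11 :: 13 :: nil)%Z)
      (map Z.of_nat (seq 2 181)).

Lemma in_trial_divisors d : (In d trial_divisors -> 2 <= d)%Z /\
  (prime d -> (d < 183)%Z -> In d trial_divisors).
Proof.
  (* The evaluated list is convertible to its sieve definition, which exposes membership. *)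
  change trial_divisors with
    (filter (fun d => forallb (fun e => (d <=? e) || negb (d mod e =? 0))%Z%bool
                       (2 :: 3 :: 5 :: 7 :: 11 :: 13 :: nil)%Z)
      (map Z.of_nat (seq 2 181))).
  rewrite filter_In, in_map_iff, forallb_forall. split.
  - intros [[k [<- Hk]] _]. apply in_seq in Hk. lia.
  - intros Hp Hd. apply prime_ge_2 in Hp as Hp2. split.
    + exists (Z.to_nat d). split; [lia|]. apply in_seq. lia.
    + intros e He. apply orb_true_iff. destruct (Z.leb_spec d e); [now left|right].
      apply negb_true_iff, Z.eqb_neq. intros E.
      assert (1 < e)%Z by (cbn [In] in He; lia).
      apply Z.mod_divide in E; [|lia]. apply prime_alt in Hp. now apply (proj2 Hp e).
Qed.

(** The guard skips divisors above the square root of [n], so a prime occurring in the list is not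
    rejected by itself. *)
Definition trial_prime (n : Z) : bool :=
  forallb (fun d => if n <? d * d then true else negb (n mod d =? 0))%Z trial_divisors.

Lemma trial_prime_correct n : (2 <= n < 33489)%Z -> (trial_prime n = true <-> prime n).
Proof.
  intros Hn. unfold trial_prime. rewrite forallb_forall. split.
  - intros H. apply prime_alt. split; [lia|]. intros m Hm [k Hk].
    (* The smaller factor is below 183 because [n < 183 ^ 2], so a prime divisor of it is in the
       list. *)
    assert (Hsmall : forall d e, (1 < d)%Z -> (1 < e)%Z -> n = (d * e)%Z -> (d <= e)%Z -> False).
    { intros d e Hd He E Hde.
      destruct (exists_prime_divisor (Z.to_nat d) ltac:(lia)) as [q [Hq Hqd]].
      assert (Hqle := Nat.divide_pos_le q (Z.to_nat d) ltac:(lia) Hqd).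
      assert (Hqd' : (Z.of_nat q <= d)%Z) by lia.
      assert (Hdd : (d * d <= n)%Z) by nia. assert (Hd183 : (d < 183)%Z) by nia.
      assert (Hin : In (Z.of_nat q) trial_divisors)
        by (apply in_trial_divisors; [exact Hq | lia]).
      assert (Hq2 := nat_prime_ge2 q Hq). apply H in Hin.
      destruct (Z.ltb_spec n (Z.of_nat q * Z.of_nat q)); [nia|].
      apply negb_true_iff, Z.eqb_neq in Hin. apply Hin. apply Z.mod_divide; [lia|].
      rewrite E. apply Z.divide_mul_l. destruct Hqd as [c Hc]. exists (Z.of_nat c). lia. }
    assert (1 < k)%Z by nia.
    destruct (Z.le_ge_cases m k); [apply (Hsmall m k) | apply (Hsmall k m)]; lia.
  - intros Hp d Hd. apply in_trial_divisors in Hd.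
    destruct (Z.ltb_spec n (d * d)); [reflexivity|].
    apply negb_true_iff, Z.eqb_neq. intros E. apply Z.mod_divide in E; [|lia].
    apply prime_alt in Hp. destruct Hp as [_ Hp]. apply (Hp d); auto. nia.
Qed.

Lemma trial_prime_nat n :
  (2 <= Z.of_nat n < 33489)%Z -> trial_prime (Z.of_nat n) = nat_primeb n.
Proof.
  intros Hn. apply bool_iff_eq. rewrite nat_primeb_iff. now apply trial_prime_correct.
Qed.

(** Each prime [n] multiplies by [n / (n - 1)]; the added 1 makes the integer quotient an upper
    bound. *)
Fixpoint mertens_scan (k : nat) (n U : Z) : Z :=
  match k with
  | O => U
  | S k => mertens_scan k (n + 1) (if trial_prime n then U * n / (n - 1) + 1 else U)%Z
  end.

Fixpoint primorial_scan (k : nat) (n M : Z) : Z :=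
  match k with
  | O => M
  | S k => primorial_scan k (n + 1) (if trial_prime n then n * M else M)%Z
  end.

Lemma mertens_scan_correct D k m U :
  (1 <= m)%nat -> (Z.of_nat (m + k) < 33489)%Z ->
  D * exp (ln_mertens_prod m) <= IZR U ->
  D * exp (ln_mertens_prod (m + k)) <= IZR (mertens_scan k (Z.of_nat (S m)) U).
Proof.
  revert m U. induction k as [|k IH]; intros m U Hm Hk H.
  - rewrite Nat.add_0_r. exact H.
  - cbn [mertens_scan]. replace (m + S k)%nat with (S m + k)%nat by lia.
    replace (Z.of_nat (S m) + 1)%Z with (Z.of_nat (S (S m))) by lia.
    apply IH; [lia|lia|]. rewrite trial_prime_nat by lia.
    unfold ln_mertens_prod in *. rewrite Rsum_primes_S.
    destruct (nat_primeb (S m)); [|now rewrite Rplus_0_r].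
    fold (ln_factor (S m)). rewrite exp_plus, exp_ln_factor by lia.
    set (P := exp _) in *. assert (HmR := INR_le_1 m Hm).
    replace (INR (S m) / (INR (S m) - 1)) with ((INR m + 1) / INR m)
      by (rewrite S_INR; f_equal; ring).
    replace (Z.of_nat (S m) - 1)%Z with (Z.of_nat m) by lia.
    assert (Hd := Z.div_mod (U * Z.of_nat (S m)) (Z.of_nat m) ltac:(lia)).
    assert (Hb := Z.mod_pos_bound (U * Z.of_nat (S m)) (Z.of_nat m) ltac:(lia)).
    set (q := (U * Z.of_nat (S m) / Z.of_nat m)%Z) in *.
    assert (Hq : (U * Z.of_nat (S m) <= Z.of_nat m * (q + 1))%Z) by lia.
    apply IZR_le in Hq. rewrite !mult_IZR, <- !INR_IZR_INZ, S_INR in Hq.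
    apply Rle_trans with (IZR U * ((INR m + 1) / INR m)).
    + rewrite <- Rmult_assoc. apply Rmult_le_compat_r; [apply Rdiv_le_0_compat; lra|auto].
    + unfold Rdiv. rewrite <- Rmult_assoc. apply Rle_div_l; [lra|]. lra.
Qed.

Lemma primorial_scan_correct k m M :
  (1 <= m)%nat -> (Z.of_nat (m + k) < 33489)%Z ->
  IZR M <= exp (theta m) ->
  IZR (primorial_scan k (Z.of_nat (S m)) M) <= exp (theta (m + k)).
Proof.
  revert m M. induction k as [|k IH]; intros m M Hm Hk H.
  - rewrite Nat.add_0_r. exact H.
  - cbn [primorial_scan]. replace (m + S k)%nat with (S m + k)%nat by lia.
    replace (Z.of_nat (S m) + 1)%Z with (Z.of_nat (S (S m))) by lia.
    apply IH; [lia|lia|]. rewrite trial_prime_nat by lia.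
    unfold theta in *. rewrite Rsum_primes_S.
    destruct (nat_primeb (S m)); [|now rewrite Rplus_0_r].
    assert (HmR : 0 < INR (S m)) by (apply lt_0_INR; lia).
    rewrite exp_plus, exp_ln by auto. rewrite mult_IZR, <- INR_IZR_INZ.
    rewrite (Rmult_comm (exp _)). apply Rmult_le_compat_l; lra.
Qed.

(* In units of 10 ^ (-6), rounded up at each step. *)
Definition mertens_upper_Z (n : nat) : Z := mertens_scan (n - 1) 2 1000000.
Definition primorial_Z (n : nat) : Z := primorial_scan (n - 1) 2 1.

Lemma primes_to_1 : primes_to 1 = nil.
Proof.
  destruct (primes_to 1) as [|p l] eqn:E; auto.
Qed.

Lemma mertens_upper_Z_correct n :
  (1 <= n)%nat -> (Z.of_nat n < 33489)%Z ->
  1000000 * exp (ln_mertens_prod n) <= IZR (mertens_upper_Z n).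
Proof.
  intros H1 H2. replace n with (1 + (n - 1))%nat at 1 by lia.
  apply (mertens_scan_correct 1000000 (n - 1) 1); [lia|lia|].
  unfold ln_mertens_prod. rewrite primes_to_1. simpl. rewrite exp_0. lra.
Qed.

Lemma primorial_Z_correct n :
  (1 <= n)%nat -> (Z.of_nat n < 33489)%Z -> IZR (primorial_Z n) <= exp (theta n).
Proof.
  intros H1 H2. replace n with (1 + (n - 1))%nat at 2 by lia.
  apply (primorial_scan_correct (n - 1) 1); [lia|lia|].
  unfold theta. rewrite primes_to_1. simpl. rewrite exp_0. lra.
Qed.

(** * Integer certificates for iterated logarithms *)

(* ln m >= log2 (m ^ 8) / 8 * ln 2, and the same device with the exponent 64 for the outer
   logarithm, using ln 2 > 0.6931 throughout; the shift keeps only 60 bits of m. *)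
Definition lnln_low (m : Z) : Z :=
  let s := Z.max 0 (Z.log2 m - 60) in
  let e := (8 * s + Z.log2 (Z.shiftr m s ^ 8))%Z in Z.log2 ((e * 6931) ^ 64 / 80000 ^ 64).

(** Take logarithms in [2 ^ log2 z <= z <= y ^ k]; the exponent [k] resolves the binary logarithm of
    [y] to steps of [1 / k]. *)
Lemma ln_lower_log2 z k y :
  (0 < z)%Z -> 0 < y -> IZR z <= y ^ k -> IZR (Z.log2 z) * ln 2 <= INR k * ln y.
Proof.
  intros Hz Hy H. assert (Hlog := Z.log2_spec z Hz). assert (Hn := Z.log2_nonneg z).
  rewrite <- ln_pow by auto.
  replace (IZR (Z.log2 z) * ln 2) with (ln (2 ^ Z.to_nat (Z.log2 z))).
  - apply ln_le_mono; [apply pow_lt; lra|]. apply Rle_trans with (2 := H).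
    rewrite pow_IZR, Z2Nat.id by auto. apply IZR_le. lia.
  - rewrite ln_pow, INR_IZR_INZ, Z2Nat.id by (auto; lra). reflexivity.
Qed.

(** The unit is [0.6931 / 64]. The condition [m >= 8] gives [e >= 24], hence a bound
    [e * 0.6931 / 8] above 1 for [ln y], so that the outer logarithm applies. *)
Lemma lnln_low_correct m y :
  (8 <= m)%Z -> IZR m <= y -> IZR (lnln_low m) * (6931 / 640000) <= ln (ln y).
Proof.
  intros Hm Hy. unfold lnln_low. set (s := Z.max 0 (Z.log2 m - 60)).
  set (m' := Z.shiftr m s). set (e := (8 * s + Z.log2 (m' ^ 8))%Z).
  assert (Hl2 := ln_2_bounds). assert (HmR : 8 <= IZR m) by now apply IZR_le.
  assert (Hs : (0 <= s)%Z) by lia.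
  assert (H2s : (0 < 2 ^ s)%Z) by (apply Z.pow_pos_nonneg; lia).
  assert (Em : m' = (m / 2 ^ s)%Z) by now apply Z.shiftr_div_pow2.
  assert (Hm' : (8 <= m')%Z).
  { rewrite Em. destruct (Z.le_ge_cases (Z.log2 m - 60) 0) as [h|h].
    - replace s with 0%Z by lia. rewrite Z.pow_0_r, Z.div_1_r. lia.
    - apply Z.div_le_lower_bound; auto. replace s with (Z.log2 m - 60)%Z by lia.
      apply Z.le_trans with (2 ^ (Z.log2 m - 60) * 2 ^ 60)%Z; [nia|].
      rewrite <- Z.pow_add_r by lia. replace (Z.log2 m - 60 + 60)%Z with (Z.log2 m) by lia.
      apply Z.log2_spec. lia. }
  assert (Hlog8 : (24 <= Z.log2 (m' ^ 8))%Z).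
  { change 24%Z with (Z.log2 (8 ^ 8)). apply Z.log2_le_mono. apply Z.pow_le_mono_l. lia. }
  assert (He : (24 <= e)%Z) by lia.
  assert (HeR : 24 <= IZR e) by now apply IZR_le.
  assert (Hm'R : 8 <= IZR m') by now apply IZR_le.
  assert (H1 : IZR e * (6931 / 80000) <= ln y).
  { assert (H : IZR (Z.log2 (m' ^ 8)) * ln 2 <= INR 8 * ln (IZR m')).
    { apply ln_lower_log2; [apply Z.pow_pos_nonneg; lia|lra|].
      change 8%Z with (Z.of_nat 8). rewrite <- pow_IZR. lra. }
    assert (Hln : ln (IZR m') + IZR s * ln 2 <= ln y).
    { replace (IZR s * ln 2) with (ln (IZR (2 ^ s))).
      - rewrite <- ln_mult; [|lra|now apply IZR_lt]. apply ln_le_mono.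
        + apply Rmult_lt_0_compat; [lra|now apply IZR_lt].
        + apply Rle_trans with (2 := Hy). rewrite <- mult_IZR. apply IZR_le.
          rewrite Em, Z.mul_comm. now apply Z.mul_div_le.
      - rewrite <- (Z2Nat.id s) at 1 by auto. rewrite <- pow_IZR, ln_pow by lra.
        now rewrite INR_IZR_INZ, Z2Nat.id. }
    rewrite INR_IZR_INZ in H. simpl (IZR (Z.of_nat 8)) in H.
    unfold e in *. rewrite plus_IZR, mult_IZR in *. nra. }
  clearbody e. clear - Hl2 HeR He H1.
  set (w := ((e * 6931) ^ 64 / 80000 ^ 64)%Z).
  assert (Hw : (1 <= w)%Z).
  { unfold w. apply Z.div_le_lower_bound; [apply Z.pow_pos_nonneg; lia|].
    rewrite Z.mul_1_r. apply Z.pow_le_mono_l. lia. }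
  assert (H2 : IZR w <= (IZR e * (6931 / 80000)) ^ 64).
  { replace (IZR e * (6931 / 80000)) with ((IZR e * 6931) / 80000) by field.
    unfold Rdiv at 1. rewrite Rpow_mult_distr, pow_inv. apply Rle_div_r; [apply pow_lt; lra|].
    rewrite <- mult_IZR, !pow_IZR, <- mult_IZR. apply IZR_le.
    rewrite Z.mul_comm. apply Z.mul_div_le. apply Z.pow_pos_nonneg; lia. }
  assert (H3 : IZR (Z.log2 w) * ln 2 <= INR 64 * ln (ln y)).
  { apply ln_lower_log2; [lia|lra|]. apply Rle_trans with (1 := H2).
    apply pow_incr. lra. }
  rewrite INR_IZR_INZ in H3. simpl (IZR (Z.of_nat 64)) in H3.
  assert (H4 : 0 <= IZR (Z.log2 w)) by apply IZR_le, Z.log2_nonneg. nra.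
Qed.

(** Tests [num / den < 1.77 * ln (ln m)] with denominators cleared; 1.77 stands for
    [exp euler_gamma]. *)
Definition ratio_ok (num den m : Z) : bool :=
  ((8 <=? m)%Z && (num * 64000000 <? den * (177 * 6931 * lnln_low m))%Z)%bool.

Lemma ratio_ok_correct num den m y :
  ratio_ok num den m = true -> (0 < den)%Z -> IZR m <= y ->
  IZR num / IZR den < 1.77 * ln (ln y).
Proof.
  intros H Hden Hy. unfold ratio_ok in H. apply andb_true_iff in H. destruct H as [H1 H2].
  apply Z.leb_le in H1. apply Z.ltb_lt in H2.
  assert (H := lnln_low_correct m y H1 Hy). apply IZR_lt in H2. apply IZR_lt in Hden.
  rewrite !mult_IZR in H2. apply Rlt_div_l; [lra|].
  apply Rlt_le_trans with (1.77 * (IZR (lnln_low m) * (6931 / 640000)) * IZR den); [lra|].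
  apply Rmult_le_compat_r; lra.
Qed.

(** Both sides are monotone in [x], so the product at [b] against [theta] at [a] settles the whole
    interval. The factor [4 / 5] meets the unit [10 ^ (- 6)] in 5000000. *)
Definition segment_ok (a b : nat) : bool :=
  ratio_ok (4 * mertens_upper_Z b) 5000000 (primorial_Z a / 5).

Lemma segment_ok_correct a b x :
  segment_ok a b = true -> (1 <= a)%nat -> (a <= x <= b)%nat -> (Z.of_nat b < 33489)%Z ->
  4 / 5 * exp (ln_mertens_prod x) < 1.77 * ln (theta x - ln 5).
Proof.
  intros H Ha Hx Hb.
  assert (HP := mertens_upper_Z_correct b ltac:(lia) Hb).
  assert (HM := primorial_Z_correct a Ha ltac:(lia)).
  assert (Hmono : exp (ln_mertens_prod x) <= exp (ln_mertens_prod b))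
    by (apply exp_le_mono, ln_mertens_prod_mono; lia).
  assert (Hth : exp (theta a) <= exp (theta x)) by (apply exp_le_mono, theta_mono; lia).
  assert (H5 : IZR (primorial_Z a / 5) <= exp (theta x - ln 5)).
  { unfold Rminus. rewrite exp_plus, exp_Ropp, exp_ln by lra. apply Rle_div_r; [lra|].
    apply Rle_trans with (IZR (primorial_Z a)); [|lra].
    rewrite <- mult_IZR. apply IZR_le. pose proof (Z.mul_div_le (primorial_Z a) 5). lia. }
  assert (Hr := ratio_ok_correct _ _ _ _ H ltac:(lia) H5). rewrite ln_exp in Hr.
  rewrite mult_IZR in Hr. lra.
Qed.

Lemma mertens_prod_medium x :
  (19 <= x)%nat -> (Z.of_nat x <= 32768)%Z ->
  4 / 5 * exp (ln_mertens_prod x) < 1.77 * ln (theta x - ln 5).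
Proof.
  intros H1 H2.
  (* Every segment begins at a prime; later segments can be longer as the slack left by [4 / 5]
     widens. *)
  destruct (le_lt_dec x 22); [apply (segment_ok_correct 19 22); [vm_compute; reflexivity|lia..]|].
  destruct (le_lt_dec x 28); [apply (segment_ok_correct 23 28); [vm_compute; reflexivity|lia..]|].
  destruct (le_lt_dec x 36); [apply (segment_ok_correct 29 36); [vm_compute; reflexivity|lia..]|].
  destruct (le_lt_dec x 58); [apply (segment_ok_correct 37 58); [vm_compute; reflexivity|lia..]|].
  destruct (le_lt_dec x 106); [apply (segment_ok_correct 59 106); [vm_compute; reflexivity|lia..]|].
  destruct (le_lt_dec x 270); [apply (segment_ok_correct 107 270); [vm_compute; reflexivity|lia..]|].
  destruct (le_lt_dec x 928); [apply (segment_ok_correct 271 928); [vm_compute; reflexivity|lia..]|].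
  destruct (le_lt_dec x 4480); [apply (segment_ok_correct 929 4480); [vm_compute; reflexivity|lia..]|].
  apply (segment_ok_correct 4481 (Z.to_nat 32768)); [vm_compute; reflexivity|lia..].
Qed.

(** * Robin's inequality *)

(** [ln] is 0 at nonpositive arguments. *)
Lemma ln_pos_inv y : 0 < ln y -> 0 < y.
Proof. unfold ln. destruct (Rlt_dec 0 y); [auto|lra]. Qed.

Lemma robin_of_ratio n c :
  (1 <= n)%nat -> INR (sigma_div n) <= INR n * c -> c < 1.77 * ln (ln (INR n)) -> 0 <= c ->
  INR (sigma_div n) < exp euler_gamma * INR n * ln (ln (INR n)).
Proof.
  intros Hn Hs Hc Hc0. apply INR_le_1 in Hn. assert (Hg := exp_euler_gamma_lower).
  apply Rle_lt_trans with (1 := Hs).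
  apply Rlt_le_trans with (INR n * (1.77 * ln (ln (INR n)))).
  - apply Rmult_lt_compat_l; lra.
  - replace (exp euler_gamma * INR n * ln (ln (INR n))) with
      (INR n * (exp euler_gamma * ln (ln (INR n)))) by ring.
    apply Rmult_le_compat_l; [lra|]. apply Rmult_le_compat_r; lra.
Qed.

(** The medium and large ranges of [x] meet at 32768. Positivity of [ln (theta x - ln 5)] follows
    since it dominates a positive quantity, and it puts the argument where [ln] is monotone. *)
Lemma robin_of_many_primes n x :
  (1 <= n)%nat -> (19 <= x)%nat ->
  INR (sigma_div n) <= INR n * (4 / 5 * exp (ln_mertens_prod x)) ->
  theta x - ln 5 <= ln (INR n) ->
  INR (sigma_div n) < exp euler_gamma * INR n * ln (ln (INR n)).
Proof.
  intros Hn Hx Hs Hl. apply INR_le_1 in Hn. assert (Hg := exp_euler_gamma_lower).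
  assert (HP := exp_pos (ln_mertens_prod x)).
  assert (H : 4 / 5 * exp (ln_mertens_prod x) < exp euler_gamma * ln (theta x - ln 5)
              /\ 0 < ln (theta x - ln 5)).
  { destruct (Z.le_gt_cases (Z.of_nat x) 32768) as [h|h].
    - assert (H := mertens_prod_medium x Hx h). split; [|lra].
      apply Rlt_le_trans with (1 := H). apply Rmult_le_compat_r; lra.
    - assert (H := mertens_prod_large x ltac:(lia)). split; [auto|].
      apply Rmult_lt_reg_l with (exp euler_gamma); lra. }
  destruct H as [H1 H2]. apply ln_pos_inv in H2 as H3.
  assert (H4 := ln_le_mono _ _ H3 Hl).
  apply Rle_lt_trans with (1 := Hs). rewrite (Rmult_comm (exp euler_gamma)), Rmult_assoc.
  apply Rmult_lt_compat_l; [lra|]. apply Rlt_le_trans with (1 := H1).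
  apply Rmult_le_compat_l; lra.
Qed.

Lemma exp_ln_mertens_prod_le x b :
  (1 <= b)%nat -> (x <= b)%nat -> (Z.of_nat b < 33489)%Z ->
  exp (ln_mertens_prod x) <= IZR (mertens_upper_Z b) / 1000000.
Proof.
  intros H1 H2 H3. apply Rle_trans with (exp (ln_mertens_prod b)).
  - now apply exp_le_mono, ln_mertens_prod_mono.
  - assert (H := mertens_upper_Z_correct b H1 H3). lra.
Qed.

Lemma prime_factor_bounds p : nat_prime p -> (p <= 5)%nat -> 0 < 1 - / INR p <= 4 / 5.
Proof.
  intros Hp Hp5. apply INR_prime_ge2 in Hp. apply le_INR in Hp5. simpl in Hp5.
  assert (/ INR p <= / 2) by (apply Rinv_le_contravar; lra).
  assert (/ 5 <= / INR p) by (apply Rinv_le_contravar; lra). lra.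
Qed.

Lemma robin_not_div_2_or_3 p n :
  nat_prime p -> (p <= 3)%nat -> ~ Nat.divide p n -> (5041 <= Z.of_nat n)%Z ->
  INR (sigma_div n) < exp euler_gamma * INR n * ln (ln (INR n)).
Proof.
  intros Hp Hp3 Hpn Hn. assert (HnR : 5041 <= INR n) by (rewrite INR_IZR_INZ; now apply IZR_le).
  destruct (sigma_bound n ltac:(lia)) as [L [H1 [H2 [H3 H4]]]].
  destruct (primes_list_compare_avoiding p n L 0 Hp ltac:(lia) Hpn H1 H2 ltac:(lra))
    as [x [Hx [H5 H6]]].
  assert (H7 := prime_factor_bounds p Hp ltac:(lia)).
  assert (HP := exp_pos (ln_mertens_prod x)).
  destruct (le_lt_dec 19 x) as [h|h].
  - apply (robin_of_many_primes n x); auto; [lia| |lra].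
    apply Rle_trans with (1 := H3). apply Rmult_le_compat_l; [lra|].
    apply Rle_trans with (1 := H5). apply Rmult_le_compat_r; lra.
  (* For [x <= 18] the factor [1 - 1 / p <= 2 / 3] is small enough for [n >= 5041] alone to
     suffice. *)
  - assert (H8 := exp_ln_mertens_prod_le x 18 ltac:(lia) ltac:(lia) ltac:(lia)).
    assert (H9 : ratio_ok (2 * mertens_upper_Z 18) 3000000 5041 = true)
      by (vm_compute; reflexivity).
    apply (ratio_ok_correct _ _ _ (INR n)) in H9; [|lia|lra]. rewrite mult_IZR in H9.
    assert (H10 : 1 - / INR p <= 2 / 3).
    { apply INR_prime_ge2 in Hp. apply le_INR in Hp3. simpl in Hp3.
      assert (/ 3 <= / INR p) by (apply Rinv_le_contravar; lra). lra. }
    apply (robin_of_ratio n (2 * IZR (mertens_upper_Z 18) / 3000000)); [lia| |lra|lra].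
    apply Rle_trans with (1 := H3). apply Rmult_le_compat_l; [lra|].
    apply Rle_trans with (1 := H5).
    apply Rle_trans with (2 / 3 * exp (ln_mertens_prod x)); [apply Rmult_le_compat_r|]; lra.
Qed.

(* a is the 2-adic valuation of n if exact, otherwise a lower bound for it; lo <= x <= hi. *)
Definition even_case_ok (exact : bool) (lo hi : nat) (a : Z) : bool :=
  ratio_ok ((if exact then 2 ^ (a + 1) - 1 else 2 ^ (a + 1)) * (4 * mertens_upper_Z hi))
    (2 ^ (a + 1) * 5000000) (Z.max 5041 (2 ^ (a - 1) * (primorial_Z lo / 5))).

(** Two lower bounds for [n] compete: 5041, and [2 ^ (b - 1)] times the primorial of [lo] over 5. If
    [b] is only a lower bound for [a], the factor [1 - 2 ^ (- (a + 1))] is replaced by 1. *)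
Lemma even_case_ratio exact lo hi b a x n :
  even_case_ok exact lo hi (Z.of_nat b) = true ->
  (1 <= b)%nat -> (b <= a)%nat -> (exact = true -> a = b) ->
  (1 <= lo)%nat -> (lo <= x <= hi)%nat -> (Z.of_nat hi < 33489)%Z -> (5041 <= Z.of_nat n)%Z ->
  INR (a - 1) * ln 2 + theta x - ln 5 <= ln (INR n) ->
  (1 - / 2 ^ S a) * (4 / 5 * exp (ln_mertens_prod x)) < 1.77 * ln (ln (INR n)).
Proof.
  intros Hok Hb Hba Hex Hlo Hx Hhi Hn Hl.
  assert (HnR : 5041 <= INR n) by (rewrite INR_IZR_INZ; now apply IZR_le).
  assert (HP := exp_ln_mertens_prod_le x hi ltac:(lia) ltac:(lia) Hhi).
  assert (HM := primorial_Z_correct lo Hlo ltac:(lia)).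
  assert (Hth : exp (theta lo) <= exp (theta x)) by (apply exp_le_mono, theta_mono; lia).
  assert (Epow : IZR (2 ^ (Z.of_nat b + 1)) = 2 ^ S b).
  { replace (Z.of_nat b + 1)%Z with (Z.of_nat (S b)) by lia. now rewrite <- pow_IZR. }
  assert (Hpos : 0 < 2 ^ S b) by (apply pow_lt; lra).
  assert (Hm : IZR (Z.max 5041 (2 ^ (Z.of_nat b - 1) * (primorial_Z lo / 5))) <= INR n).
  { apply Z.max_case; [exact HnR|].
    replace (Z.of_nat b - 1)%Z with (Z.of_nat (b - 1)) by lia.
    rewrite mult_IZR, <- pow_IZR.
    apply exp_le_mono in Hl. rewrite exp_ln in Hl by lra. apply Rle_trans with (2 := Hl).
    unfold Rminus. rewrite !exp_plus, exp_Ropp, exp_ln, Rmult_assoc by lra.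
    rewrite <- exp_pow_INR, exp_ln by lra.
    apply Rmult_le_compat; [left; apply pow_lt; lra| |apply Rle_pow; lia || lra|].
    - apply IZR_le, Z.div_pos; [|lia].
      unfold primorial_Z. generalize (lo - 1)%nat. intros k.
      assert (G : forall k i M, (0 <= i)%Z -> (0 <= M)%Z -> (0 <= primorial_scan k i M)%Z).
      { clear. induction k as [|k IH]; intros i M Hi HM; [auto|]. cbn [primorial_scan].
        apply IH; [lia|]. destruct (trial_prime i); nia. }
      apply G; lia.
    - apply Rle_div_r; [lra|]. apply Rle_trans with (IZR (primorial_Z lo)); [|lra].
      rewrite <- mult_IZR. apply IZR_le. pose proof (Z.mul_div_le (primorial_Z lo) 5). lia. }
  assert (Hr := ratio_ok_correct _ _ _ _ Hok
    ltac:(apply Z.mul_pos_pos; [apply Z.pow_pos_nonneg|]; lia) Hm).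
  apply Rle_lt_trans with (2 := Hr).
  set (U := mertens_upper_Z hi) in *. rewrite !mult_IZR, Epow.
  assert (HE := exp_pos (ln_mertens_prod x)).
  assert (Hfac : 1 - / 2 ^ S a <= 1).
  { assert (0 < / 2 ^ S a) by (apply Rinv_0_lt_compat, pow_lt; lra). lra. }
  destruct exact.
  - rewrite (Hex eq_refl) in *. rewrite minus_IZR, Epow.
    replace (((2 ^ S b - 1) * (4 * IZR U)) / (2 ^ S b * 5000000)) with
      ((1 - / 2 ^ S b) * (4 / 5 * (IZR U / 1000000))) by (field; lra).
    apply Rmult_le_compat_l; [|lra].
    assert (/ 2 ^ S b <= / 1) by (apply Rinv_le_contravar; [lra|apply pow_R1_Rle; lra]). lra.
  - rewrite Epow.
    replace ((2 ^ S b * (4 * IZR U)) / (2 ^ S b * 5000000)) with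
      (4 / 5 * (IZR U / 1000000)) by (field; lra).
    apply Rle_trans with (1 * (4 / 5 * exp (ln_mertens_prod x))); [|lra].
    apply Rmult_le_compat_r; lra.
Qed.

(** Valuations 1 to 5 use their exact factor; from 6 on, the power of 2 makes [n] large enough to do
    without it. *)
Definition even_cases_ok (lo hi : nat) : bool :=
  even_case_ok true lo hi 1 && even_case_ok true lo hi 2 && even_case_ok true lo hi 3 &&
  even_case_ok true lo hi 4 && even_case_ok true lo hi 5 && even_case_ok false lo hi 6.

Lemma even_cases_ratio lo hi a x n :
  even_cases_ok lo hi = true -> (1 <= a)%nat ->
  (1 <= lo)%nat -> (lo <= x <= hi)%nat -> (Z.of_nat hi < 33489)%Z -> (5041 <= Z.of_nat n)%Z ->
  INR (a - 1) * ln 2 + theta x - ln 5 <= ln (INR n) ->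
  (1 - / 2 ^ S a) * (4 / 5 * exp (ln_mertens_prod x)) < 1.77 * ln (ln (INR n)).
Proof.
  intros Hok. unfold even_cases_ok in Hok. rewrite !andb_true_iff in Hok.
  destruct Hok as [[[[[H1 H2] H3] H4] H5] H6]. intros Ha Hlo Hx Hhi Hn Hl.
  destruct (le_lt_dec 6 a) as [h|h].
  - apply (even_case_ratio false lo hi 6 a); auto; [lia|discriminate].
  - assert (Hc : (a = 1 \/ a = 2 \/ a = 3 \/ a = 4 \/ a = 5)%nat) by lia.
    destruct Hc as [->|[->|[->|[->| ->]]]].
    + apply (even_case_ratio true lo hi 1 1); auto.
    + apply (even_case_ratio true lo hi 2 2); auto.
    + apply (even_case_ratio true lo hi 3 3); auto.
    + apply (even_case_ratio true lo hi 4 4); auto.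
    + apply (even_case_ratio true lo hi 5 5); auto.
Qed.

Lemma robin_even_not_div_5 n :
  Nat.divide 2 n -> ~ Nat.divide 5 n -> (5041 <= Z.of_nat n)%Z ->
  INR (sigma_div n) < exp euler_gamma * INR n * ln (ln (INR n)).
Proof.
  intros H2n H5n Hn. assert (HnR : 5041 <= INR n) by (rewrite INR_IZR_INZ; now apply IZR_le).
  assert (Hp5 : nat_prime 5) by (apply (trial_prime_correct 5); [lia|vm_compute; reflexivity]).
  destruct (sigma_bound_even n ltac:(lia) H2n) as [a [L [Ha [H1 [H2 [H3 H4]]]]]].
  destruct (primes_list_compare_avoiding 5 n L (INR (a - 1) * ln 2)) as [x [Hx [H5 H6]]]; auto.
  replace (1 - / INR 5) with (4 / 5) in H5 by (simpl; lra).
  assert (HP := exp_pos (ln_mertens_prod x)).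
  assert (Hpow : 0 < / 2 ^ S a <= 1).
  { split; [apply Rinv_0_lt_compat, pow_lt; lra|]. rewrite <- Rinv_1.
    apply Rinv_le_contravar; [lra|apply pow_R1_Rle; lra]. }
  assert (Hs : INR (sigma_div n) <= INR n * ((1 - / 2 ^ S a) * (4 / 5 * exp (ln_mertens_prod x)))).
  { apply Rle_trans with (1 := H3). rewrite Rmult_assoc. apply Rmult_le_compat_l; [lra|].
    apply Rmult_le_compat_l; lra. }
  destruct (le_lt_dec 19 x) as [h|h].
  - apply (robin_of_many_primes n x); auto; [lia| |].
    + apply Rle_trans with (1 := Hs). apply Rmult_le_compat_l; [lra|].
      apply Rle_trans with (1 * (4 / 5 * exp (ln_mertens_prod x))); [|lra].
      apply Rmult_le_compat_r; lra.
    + assert (0 <= INR (a - 1) * ln 2)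
        by (apply Rmult_le_pos; [apply pos_INR|apply ln_nonneg; lra]). lra.
  - apply (robin_of_ratio n _ ltac:(lia) Hs).
    2:{ apply Rmult_le_pos; [|apply Rmult_le_pos]; lra. }
    (* With only the primes up to 7, [n >= 5041] suffices. The ranges 11 to 12, 13 to 16 and 17 to
       18 have constant prime sets and need the valuation of 2. *)
    destruct (le_lt_dec x 10) as [h1|h1].
    + assert (H7 := exp_ln_mertens_prod_le x 10 ltac:(lia) h1 ltac:(lia)).
      assert (H8 : ratio_ok (4 * mertens_upper_Z 10) 5000000 5041 = true)
        by (vm_compute; reflexivity).
      apply (ratio_ok_correct _ _ _ (INR n)) in H8; [|lia|lra]. rewrite mult_IZR in H8.
      apply Rle_lt_trans with (2 := H8).
      apply Rle_trans with (1 * (4 / 5 * exp (ln_mertens_prod x))); [|lra].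
      apply Rmult_le_compat_r; lra.
    + destruct (le_lt_dec x 12) as [h2|h2].
      { apply (even_cases_ratio 11 12); [vm_compute; reflexivity|lia..|lra]. }
      destruct (le_lt_dec x 16) as [h3|h3].
      { apply (even_cases_ratio 13 16); [vm_compute; reflexivity|lia..|lra]. }
      apply (even_cases_ratio 17 18); [vm_compute; reflexivity|lia..|lra].
Qed.

(** A prime above 5 has 2, 3 and 5 below it, whereas [j - 1 <= 2]. *)
Lemma jth_prime_le_5 j p :
  (1 <= j <= 3)%nat -> is_jth_prime j p -> nat_prime p /\ (p <= 5)%nat.
Proof.
  intros Hj [Hp Hc]. split; auto. apply Nat.nlt_ge. intros Hlt.
  assert (H : (length (2 :: 3 :: 5 :: nil) <= prime_count_below p)%nat).
  { unfold prime_count_below. apply NoDup_incl_length.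
    - repeat constructor; simpl; lia.
    - assert (Ht : forall q, trial_prime (Z.of_nat q) = true -> (2 <= q <= 5)%nat ->
        In q (filter nat_primeb (seq 0 p))).
      { intros q Hq Hq5. apply filter_In. split; [apply in_seq; lia|].
        rewrite <- trial_prime_nat by lia. exact Hq. }
      intros q [<-|[<-|[<-|[]]]]; apply Ht; try lia; vm_compute; reflexivity. }
  simpl in H. lia.
Qed.

Theorem mainTheorem1 (j p n : nat) :
  (1 <= j <= 3)%nat ->
  is_jth_prime j p ->
  (5040 < n)%nat ->
  ~ Nat.divide p n ->
  INR (sigma_div n) < exp euler_gamma * INR n * ln (ln (INR n)).
Proof.
  intros Hj Hjp Hn Hpn. destruct (jth_prime_le_5 j p Hj Hjp) as [Hp Hp5].
  assert (HnZ : (5041 <= Z.of_nat n)%Z).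
  { apply Nat2Z.inj_lt in Hn. change (Z.of_nat 5040) with 5040%Z in Hn. lia. }
  destruct (le_lt_dec p 3) as [h|h].
  - now apply (robin_not_div_2_or_3 p).
  - destruct (Nat.eq_dec (n mod 2) 0) as [h2|h2].
    + apply Nat.Lcm0.mod_divide in h2. assert (Hp' : p = 5%nat).
      { assert (p <> 4%nat); [|lia]. intros ->.
        assert (E : 2%nat = 4%nat); [|discriminate E].
        apply nat_prime_divide_prime; [exact prime_2|auto|]. now exists 2%nat. }
      subst p. now apply robin_even_not_div_5.
    (* An odd [n] avoids the prime 2, so the stronger factor for 2 applies in place of that for
       5. *)
    + apply (robin_not_div_2_or_3 2); auto; [exact prime_2|].
      intros Hd. apply h2. now apply Nat.Lcm0.mod_divide.
Qed.
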